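(* Let $\boldsymbol d=\boldsymbol{\Pi}^0_3\setminus\boldsymbol{\Delta}^0_3$ be the Wadge degree of the complete $\boldsymbol{\Pi}^0_3$ subsets of $2^\omega$, and $\mathscr W_{\boldsymbol d}=\{[A]\in\mathrm{MALG}:\Phi(A)\in\boldsymbol d\}$. Then $\mathscr W_{\boldsymbol d}$ is dense in $\mathrm{MALG}$ in the sense of forcing: for every $[A]\in\mathrm{MALG}$ with $\mu(A)>0$ there is $[B]\in\mathscr W_{\boldsymbol d}$ with $\mu(B)>0$ and $\mu(B\setminus A)=0$. Moreover $\boldsymbol d$ is the unique Wadge degree $\boldsymbol e$ for which $\mathscr W_{\boldsymbol e}=\{[A]:\Phi(A)\in\boldsymbol e\}$ is dense in this sense.
   Context: $2^\omega$ is the Cantor space; $N_s=\{x:s\subset x\}$; $\mu$ is the coin-tossing measure, $\mu(N_s)=2^{-\mathrm{lh}(s)}$. $\Phi(A)=\{x:\lim_n\mu(A\cap N_{x\restriction n})/\mu(N_{x\restriction n})=1\}$. $\mathrm{MALG}$ is the measure algebra of measurable sets modulo null sets, partially ordered by $[A]\le[B]\iff\mu(A\setminus B)=0$, with least element $0=[\emptyset]$. A set $D\subseteq\mathrm{MALG}\setminus\{0\}$ is dense in the sense of forcing if every $b\in\mathrm{MALG}\setminus\{0\}$ has some $d\in D$ with $d\le b$. $\boldsymbol{\Pi}^0_3$: $F_{\sigma\delta}$ sets; $\boldsymbol{\Delta}^0_3$: sets both $F_{\sigma\delta}$ and $G_{\delta\sigma}$. A Wadge degree is an equivalence class under $X\equiv_W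 Y$, where $X\le_W Y$ iff $X=f^{-1}(Y)$ for a continuous $f:2^\omega\to2^\omega$. *)

(* Defs.v *)
From Stdlib Require Import Reals List.
Open Scope R_scope.

Definition cantor := nat -> bool.
Definition cset := cantor -> Prop.

Definition restr (x : cantor) (n : nat) : list bool := map x (seq 0 n).

Definition N (s : list bool) : cset :=
  fun x => forall i, (i < length s)%nat -> x i = nth i s false.

Definition muN (s : list bool) : R := (/ 2) ^ (length s).

Definition covers_le (A : cset) (r : R) : Prop :=
  exists s : nat -> list bool,
    (forall x, A x -> exists k, N (s k) x) /\
    (forall n, sum_f_R0 (fun k => muN (s k)) n <= r).

Definition is_glb (E : R -> Prop) (m : R) : Prop :=
  (forall r, E r -> m <= r) /\ (forall b, (forall r, E r -> b <= r) -> b <= m).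

(** [outer A m]: m is the (coin-tossing) outer measure of A, i.e.
    m = inf { r : covers_le A r }.  On measurable sets this is mu. *)
Definition outer (A : cset) (m : R) : Prop := is_glb (covers_le A) m.

Definition measurable (A : cset) : Prop :=
  forall (E : cset) mE m1 m2,
    outer E mE ->
    outer (fun x => E x /\ A x) m1 ->
    outer (fun x => E x /\ ~ A x) m2 ->
    mE = m1 + m2.

Definition Phi (A : cset) : cset :=
  fun x => exists m : nat -> R,
    (forall n, outer (fun y => A y /\ N (restr x n) y) (m n)) /\
    Un_cv (fun n => m n / muN (restr x n)) 1.

Definition open (U : cset) : Prop :=
  forall x, U x -> exists n, forall y, N (restr x n) y -> U y.
Definition closed (F : cset) : Prop := open (fun x => ~ F x).

Definition Sigma02 (A : cset) : Prop :=
  exists F : nat -> cset, (forall n, closed (F n)) /\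
    (forall x, A x <-> exists n, F n x).
Definition Pi02 (A : cset) : Prop :=
  exists G : nat -> cset, (forall n, open (G n)) /\
    (forall x, A x <-> forall n, G n x).
Definition Pi03 (A : cset) : Prop :=
  exists B : nat -> cset, (forall n, Sigma02 (B n)) /\
    (forall x, A x <-> forall n, B n x).
Definition Sigma03 (A : cset) : Prop :=
  exists B : nat -> cset, (forall n, Pi02 (B n)) /\
    (forall x, A x <-> exists n, B n x).
Definition Delta03 (A : cset) : Prop := Pi03 A /\ Sigma03 A.

Definition continuous (f : cantor -> cantor) : Prop :=
  forall x n, exists m, forall y, N (restr x m) y ->
    forall i, (i < n)%nat -> f y i = f x i.

Definition wadge_le (X Y : cset) : Prop :=
  exists f, continuous f /\ forall x, X x <-> Y (f x).

Definition wadge_degree (e : cset -> Prop) : Prop :=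
  exists Y, forall X, e X <-> (wadge_le X Y /\ wadge_le Y X).

Definition d_Pi03 (X : cset) : Prop := Pi03 X /\ ~ Delta03 X.

Definition W (e : cset -> Prop) (A : cset) : Prop := e (Phi A).

Definition dense_in_MALG (P : cset -> Prop) : Prop :=
  forall A, measurable A -> (exists m, outer A m /\ 0 < m) ->
    exists B, measurable B /\ P B /\ (exists m, outer B m /\ 0 < m) /\
      outer (fun x => B x /\ ~ A x) 0.

(* Main.v *)
(** Let [P3] be the set of matrices of bits with finitely many ones in each row.  It is complete
    for [Pi03] and not [Sigma03], and every [Pi03] set that is not [Sigma03] is above it in the
    Wadge order; the last point is proved by a direct Baire category construction, so no
    determinacy is needed.

    If [B] has positive measure and is contained, up to a null set, in a closed set with empty
    interior, then [P3] reduces to [Phi B]: every branch can be steered to a cylinder where the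
    density of [B] is 0, hence through any prescribed small density deficit, and the martingale
    inequality for the densities allows it to climb back towards density 1 without falling much
    lower.  So [Phi B] is complete.  Every set of positive measure contains such a [B] (intersect
    it with a nowhere dense closed set of almost full measure), and below a nowhere dense closed
    set of positive measure there is nothing else, whence the uniqueness of the degree. *)

From Stdlib Require Import Reals List Lia Lra Arith Cantor Wf_nat FinFun.
From Stdlib Require Import Classical ClassicalEpsilon FunctionalExtensionality PropExtensionality.
Require Import Defs.
Import ListNotations.

(** Both reductions from [P3] are priority constructions. A one in row [i] preserves what was
    secured up to level [i] and undoes what lies above. If every row has finitely many ones, each
    level is eventually undisturbed; otherwise the least row with infinitely many ones makes the
    limit fail. Densities are formed with outer measure, and the estimates along branches come from
    covers and countable subadditivity. Additivity is confined to showing that the sets handed to or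
    returned for [dense_in_MALG] are measurable. *)

(** * Choice, least witnesses and uniform bounds *)

Lemma choose {A B : Type} (P : A -> B -> Prop) :
  (forall a, exists b, P a b) -> exists f, forall a, P a (f a).
Proof.
  intros H.
  exists (fun a => proj1_sig (constructive_indefinite_description _ (H a))).
  intros a. exact (proj2_sig (constructive_indefinite_description _ (H a))).
Qed.

Lemma cset_ext (A B : cset) : (forall x, A x <-> B x) -> A = B.
Proof.
  intros H. extensionality x. apply propositional_extensionality, H.
Qed.

Lemma least_nat (P : nat -> Prop) :
  (exists n, P n) -> exists n, P n /\ forall k, (k < n)%nat -> ~ P k.
Proof.
  intros [n Hn]. induction n as [n IH] using lt_wf_ind.
  destruct (classic (exists k, (k < n)%nat /\ P k)) as [[k [Hk Pk]]|Hno].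
  - exact (IH k Hk Pk).
  - exists n. split; [exact Hn|]. intros k Hk Pk. apply Hno. now exists k.
Qed.

Lemma uniform_bound (P : nat -> nat -> Prop) (n : nat) :
  (forall i, (i < n)%nat -> exists T, forall t, (T <= t)%nat -> P i t) ->
  exists T, forall i t, (i < n)%nat -> (T <= t)%nat -> P i t.
Proof.
  induction n as [|n IH]; intros H.
  - exists 0%nat. intros i t Hi. lia.
  - destruct IH as [T HT]; [intros i Hi; apply H; lia|].
    destruct (H n ltac:(lia)) as [T' HT'].
    exists (Nat.max T T'). intros i t Hi Ht.
    destruct (Nat.eq_dec i n) as [->|]; [apply HT'; lia|apply HT; lia].
Qed.

(** * Finite strings and cylinders *)

Definition prefix (s u : list bool) : Prop := exists v, u = s ++ v.

Lemma prefix_refl s : prefix s s.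
Proof. exists []. now rewrite app_nil_r. Qed.

Lemma prefix_trans s t u : prefix s t -> prefix t u -> prefix s u.
Proof. intros [v ->] [w ->]. exists (v ++ w). now rewrite app_assoc. Qed.

Lemma prefix_snoc s b : prefix s (s ++ [b]).
Proof. now exists [b]. Qed.

Lemma prefix_length s u : prefix s u -> (length s <= length u)%nat.
Proof. intros [v ->]. rewrite length_app. lia. Qed.

Lemma prefix_nth s u i :
  prefix s u -> (i < length s)%nat -> nth i u false = nth i s false.
Proof. intros [v ->] Hi. now rewrite app_nth1. Qed.

Lemma length_restr x n : length (restr x n) = n.
Proof. unfold restr. now rewrite length_map, length_seq. Qed.

Lemma nth_restr x n i : (i < n)%nat -> nth i (restr x n) false = x i.
Proof.
  intros Hi. unfold restr.
  rewrite nth_indep with (d' := x 0%nat) by now rewrite length_map, length_seq.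
  rewrite map_nth, seq_nth by exact Hi. reflexivity.
Qed.

Lemma N_restr x n y : N (restr x n) y <-> forall i, (i < n)%nat -> y i = x i.
Proof.
  unfold N. rewrite length_restr.
  split; intros H i Hi; specialize (H i Hi); rewrite nth_restr in * by exact Hi; exact H.
Qed.

Lemma N_restr_self x n : N (restr x n) x.
Proof. now apply N_restr. Qed.

Lemma restr_N s x : N s x -> restr x (length s) = s.
Proof.
  intros H. apply nth_ext with (d := false) (d' := false); [apply length_restr|].
  rewrite length_restr. intros i Hi. rewrite nth_restr by exact Hi. now apply H.
Qed.

Lemma N_prefix s u x : prefix s u -> N u x -> N s x.
Proof.
  intros Hp Hu i Hi. rewrite <- (prefix_nth s u i Hp Hi). apply Hu.
  apply prefix_length in Hp. lia.
Qed.

Lemma restr_split x m n : (m <= n)%nat -> prefix (restr x m) (restr x n).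
Proof.
  intros H. exists (map x (seq m (n - m))). unfold restr.
  rewrite <- map_app, <- seq_app. do 2 f_equal. lia.
Qed.

Lemma N_comparable s u x :
  N s x -> N u x -> (length s <= length u)%nat -> prefix s u.
Proof.
  intros Hs Hu Hl. rewrite <- (restr_N s x Hs), <- (restr_N u x Hu).
  now apply restr_split.
Qed.

Lemma prefix_restr s x n : N s x -> (length s <= n)%nat -> prefix s (restr x n).
Proof.
  intros Hs Hn. apply N_comparable with x; [exact Hs|apply N_restr_self|].
  now rewrite length_restr.
Qed.

Lemma N_inhabited s : exists x, N s x.
Proof. now exists (fun i => nth i s false). Qed.

Lemma N_children s x : N s x -> N (s ++ [false]) x \/ N (s ++ [true]) x.
Proof.
  intros Hs.
  assert (H : N (s ++ [x (length s)]) x).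
  { intros i Hi. rewrite length_app in Hi. simpl in Hi.
    destruct (Nat.eq_dec i (length s)) as [->|].
    - now rewrite nth_middle.
    - rewrite app_nth1 by lia. apply Hs. lia. }
  destruct (x (length s)); auto.
Qed.

Lemma N_cons b t x : N (b :: t) x <-> x 0%nat = b /\ N t (fun i => x (S i)).
Proof.
  split.
  - intros H. split; [apply (H 0%nat); simpl; lia|].
    intros i Hi. apply (H (S i)). simpl. lia.
  - intros [H0 H] [|i] Hi; [exact H0|]. apply H. simpl in Hi. lia.
Qed.

Lemma chain_limit (q : nat -> list bool) :
  (forall n, prefix (q n) (q (S n)) /\ (length (q n) < length (q (S n)))%nat) ->
  exists x, forall n, N (q n) x.
Proof.
  intros H.
  assert (Hl : forall n, (n <= length (q n))%nat).
  { induction n as [|n IH]; [lia|]. destruct (H n). lia. }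
  assert (Hp : forall m n, (m <= n)%nat -> prefix (q m) (q n)).
  { intros m n Hmn. induction Hmn as [|n Hmn IH]; [apply prefix_refl|].
    apply prefix_trans with (q n); [exact IH|apply H]. }
  (* [q (S i)] has length at least [S i], so bit [i] is already settled there. *)
  exists (fun i => nth i (q (S i)) false). intros n i Hi.
  destruct (Nat.le_ge_cases n (S i)) as [Hn|Hn].
  - now apply prefix_nth; [apply Hp|].
  - symmetry. apply prefix_nth; [now apply Hp|]. specialize (Hl (S i)). lia.
Qed.

Lemma strings_countable : exists e : nat -> list bool, forall s, exists n, e n = s.
Proof.
  (* Base 2 with digits 1 and 2: unlike with digits 0 and 1, the length is not lost. *)
  set (code := fix code (s : list bool) : nat :=
    match s with [] => 0%nat | b :: s => S (2 * code s + if b then 1 else 0) end).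
  assert (inj : forall s u, code s = code u -> s = u).
  { induction s as [|b s IH]; intros [|c u] Heq; simpl in Heq; try lia; [reflexivity|].
    assert (b = c /\ code s = code u) as [-> Hc]
      by (destruct b, c; split; try reflexivity; lia).
    now rewrite (IH u Hc). }
  exists (fun n => epsilon (inhabits []) (fun s => code s = n)).
  intros s. exists (code s). apply inj.
  apply (epsilon_spec (inhabits []) (fun u => code u = code s)). now exists s.
Qed.

(** The transducer reads [a t] at stage [t] and extends its output; [f a] is the limit of the
    output strings. *)
Lemma transducer (St : Type) (out : St -> list bool) (Inv : nat -> St -> Prop)
    (Rel : nat -> bool -> St -> St -> Prop) (st0 : St) :
  Inv 0%nat st0 ->
  (forall t b st, Inv t st -> exists st',
     Inv (S t) st' /\ Rel t b st st' /\
     prefix (out st) (out st') /\ (length (out st) < length (out st'))%nat) ->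
  exists f, continuous f /\ forall a, exists run : nat -> St, forall t,
    Inv t (run t) /\ Rel t (a t) (run t) (run (S t)) /\
    prefix (out (run t)) (out (run (S t))) /\
    (t <= length (out (run t)))%nat /\ N (out (run t)) (f a).
Proof.
  intros H0 Hstep.
  set (step := fun t b st => epsilon (inhabits st0) (fun st' =>
     Inv (S t) st' /\ Rel t b st st' /\
     prefix (out st) (out st') /\ (length (out st) < length (out st'))%nat)).
  set (run := fix run (a : cantor) (t : nat) : St :=
     match t with O => st0 | S t => step t (a t) (run a t) end).
  assert (Hs : forall t b st, Inv t st -> Inv (S t) (step t b st) /\ Rel t b st (step t b st) /\
     prefix (out st) (out (step t b st)) /\ (length (out st) < length (out (step t b st)))%nat).
  { intros t b st Hi. apply (epsilon_spec (inhabits st0) _ (Hstep t b st Hi)). }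
  assert (Hi : forall a t, Inv t (run a t)).
  { intros a t. induction t as [|t IH]; [exact H0|]. apply (Hs t (a t) _ IH). }
  assert (Hagree : forall a a' t, (forall i, (i < t)%nat -> a' i = a i) -> run a' t = run a t).
  { intros a a' t. induction t as [|t IH]; intros H; [reflexivity|].
    simpl. rewrite IH by (intros; apply H; lia). now rewrite (H t) by lia. }
  destruct (choose (fun a y => forall t, N (out (run a t)) y)) as [f Hf].
  { intros a. apply (chain_limit (fun t => out (run a t))).
    intros t. destruct (Hs t (a t) _ (Hi a t)) as [_ [_ [H1 H2]]]. now split. }
  assert (Hlen : forall a t, (t <= length (out (run a t)))%nat).
  { intros a t. induction t as [|t IH]; [lia|].
    destruct (Hs t (a t) _ (Hi a t)) as [_ [_ [_ H]]].
    change (run a (S t)) with (step t (a t) (run a t)). lia. }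
  exists f. split.
  (* Every stage reads one bit and writes at least one, so [n] input bits fix [n] output bits. *)
  - intros x n. exists n. intros y Hy i Hin.
    assert (He : run y n = run x n) by (apply Hagree; now apply N_restr).
    pose proof (Hlen x n).
    rewrite (Hf x n i), (Hf y n i) by (rewrite ?He; lia). now rewrite He.
  - intros a. exists (run a). intros t.
    destruct (Hs t (a t) _ (Hi a t)) as [_ [H1 [H2 _]]].
    repeat split; auto.
Qed.

(** * Borel classes *)

Lemma pair_exists (Q : nat -> nat -> Prop) :
  (exists i j, Q i j) <-> exists n, Q (fst (of_nat n)) (snd (of_nat n)).
Proof.
  split.
  - intros (i & j & H). exists (to_nat (i, j)). now rewrite cancel_of_to.
  - intros [n H]. eauto.
Qed.

Lemma pair_forall (Q : nat -> nat -> Prop) :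
  (forall i j, Q i j) <-> forall n, Q (fst (of_nat n)) (snd (of_nat n)).
Proof.
  split; [auto|]. intros H i j. specialize (H (to_nat (i, j))).
  now rewrite cancel_of_to in H.
Qed.

Lemma closed_N s : closed (N s).
Proof.
  intros x Hx. exists (length s). intros y Hy Hn. apply Hx.
  rewrite <- (restr_N s y Hn). apply N_restr. intros i Hi.
  symmetry. now apply (proj1 (N_restr _ _ _) Hy).
Qed.

Lemma closed_inter A B : closed A -> closed B -> closed (fun x => A x /\ B x).
Proof.
  intros HA HB x Hx.
  destruct (classic (A x)) as [Ha|Ha].
  - destruct (HB x) as [n Hn]; [tauto|]. exists n. intros y Hy [_ H]. exact (Hn y Hy H).
  - destruct (HA x Ha) as [n Hn]. exists n. intros y Hy [H _]. exact (Hn y Hy H).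
Qed.

Lemma closed_approx A x : closed A -> (forall n, exists y, N (restr x n) y /\ A y) -> A x.
Proof.
  intros HA H. apply NNPP. intros Hx. destruct (HA x Hx) as [n Hn].
  destruct (H n) as [y [Hy Ay]]. exact (Hn y Hy Ay).
Qed.

(** The predicate is the topological closure of [A]; the kernel [D] below has this form. *)
Lemma closed_adherence A : closed (fun x => forall n, exists y, N (restr x n) y /\ A y).
Proof.
  intros x Hx. apply not_all_ex_not in Hx. destruct Hx as [n Hn].
  exists n. intros y Hy H. apply Hn. destruct (H n) as [z [Hz Az]].
  exists z. split; [|exact Az]. rewrite N_restr in *. intros i Hi.
  rewrite Hz by exact Hi. now apply Hy.
Qed.

Lemma closed_Sigma02 A : closed A -> Sigma02 A.
Proof.
  intros HA. exists (fun _ => A). split; [auto|].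
  intros x. split; [now exists 0%nat|now intros [_ H]].
Qed.

Lemma Sigma02_union (A : nat -> cset) :
  (forall n, Sigma02 (A n)) -> Sigma02 (fun x => exists n, A n x).
Proof.
  intros H. destruct (choose _ H) as [F HF].
  exists (fun n => F (fst (of_nat n)) (snd (of_nat n))). split.
  - intros n. apply HF.
  - intros x. rewrite <- (pair_exists (fun i j => F i j x)).
    split; intros [n Hn]; exists n; now apply (proj2 (HF n)).
Qed.

Lemma Sigma03_union (A : nat -> cset) :
  (forall n, Sigma03 (A n)) -> Sigma03 (fun x => exists n, A n x).
Proof.
  intros H. destruct (choose _ H) as [F HF].
  exists (fun n => F (fst (of_nat n)) (snd (of_nat n))). split.
  - intros n. apply HF.
  - intros x. rewrite <- (pair_exists (fun i j => F i j x)).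
    split; intros [n Hn]; exists n; now apply (proj2 (HF n)).
Qed.

Lemma Pi02_inter (A : nat -> cset) :
  (forall n, Pi02 (A n)) -> Pi02 (fun x => forall n, A n x).
Proof.
  intros H. destruct (choose _ H) as [F HF].
  exists (fun n => F (fst (of_nat n)) (snd (of_nat n))). split.
  - intros n. apply HF.
  - intros x. rewrite <- (pair_forall (fun i j => F i j x)).
    split; intros Hn n; now apply (proj2 (HF n)).
Qed.

Lemma Pi02_not_Sigma02 A : Sigma02 A -> Pi02 (fun x => ~ A x).
Proof.
  intros [F [HF HA]]. exists (fun n x => ~ F n x). split; [exact HF|].
  intros x. rewrite HA. split; [intros H n Hn; apply H; now exists n|].
  intros H [n Hn]. exact (H n Hn).
Qed.

Lemma closed_Pi02 A : closed A -> Pi02 A.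
Proof.
  intros HA. exists (fun n x => exists y, N (restr x n) y /\ A y). split.
  - intros n x [y [Hy Ay]]. exists n. intros z Hz. exists y. split; [|exact Ay].
    rewrite N_restr in *. intros i Hi. rewrite Hz by exact Hi. now apply Hy.
  - intros x. split; [|now apply closed_approx].
    intros Ax n. exists x. split; [apply N_restr_self|exact Ax].
Qed.

Lemma Pi02_Sigma03 A : Pi02 A -> Sigma03 A.
Proof.
  intros HA. exists (fun _ => A). split; [auto|].
  intros x. split; [now exists 0%nat|now intros [_ H]].
Qed.

Lemma Pi02_inter2 A B : Pi02 A -> Pi02 B -> Pi02 (fun x => A x /\ B x).
Proof.
  intros HA HB.
  replace (fun x => A x /\ B x) with
    (fun x => forall n : nat, (match n with O => A | S _ => B end) x).
  - apply Pi02_inter. now intros [|n].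
  - apply cset_ext. intros x. split; [intros H; exact (conj (H 0%nat) (H 1%nat))|].
    intros [Ha Hb] [|n]; assumption.
Qed.

Lemma Sigma02_union2 A B : Sigma02 A -> Sigma02 B -> Sigma02 (fun x => A x \/ B x).
Proof.
  intros HA HB.
  replace (fun x => A x \/ B x) with
    (fun x => exists n : nat, (match n with O => A | S _ => B end) x).
  - apply Sigma02_union. now intros [|n].
  - apply cset_ext. intros x. split; [now intros [[|n] H]; auto|].
    intros [H|H]; [now exists 0%nat|now exists 1%nat].
Qed.

Lemma Sigma03_union2 A B : Sigma03 A -> Sigma03 B -> Sigma03 (fun x => A x \/ B x).
Proof.
  intros HA HB.
  replace (fun x => A x \/ B x) with
    (fun x => exists n : nat, (match n with O => A | S _ => B end) x).
  - apply Sigma03_union. now intros [|n].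
  - apply cset_ext. intros x. split; [now intros [[|n] H]; auto|].
    intros [H|H]; [now exists 0%nat|now exists 1%nat].
Qed.

Lemma closed_empty : closed (fun _ => False).
Proof. intros x _. exists 0%nat. auto. Qed.

Lemma Sigma03_empty : Sigma03 (fun _ => False).
Proof. apply Pi02_Sigma03, closed_Pi02, closed_empty. Qed.

Lemma open_preimage f U : continuous f -> open U -> open (fun x => U (f x)).
Proof.
  intros Hf HU x Hx. destruct (HU _ Hx) as [n Hn]. destruct (Hf x n) as [m Hm].
  exists m. intros y Hy. apply Hn, N_restr. now apply Hm.
Qed.

Lemma Pi03_wadge X Y : wadge_le X Y -> Pi03 Y -> Pi03 X.
Proof.
  intros [f [Hf HX]] [B [HB HY]]. exists (fun n x => B n (f x)). split.
  - intros n. destruct (HB n) as [F [HF HBn]]. exists (fun k x => F k (f x)). split.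
    + intros k. exact (open_preimage f _ Hf (HF k)).
    + intros x. apply HBn.
  - intros x. rewrite HX. apply HY.
Qed.

Lemma Sigma03_wadge X Y : wadge_le X Y -> Sigma03 Y -> Sigma03 X.
Proof.
  intros [f [Hf HX]] [B [HB HY]]. exists (fun n x => B n (f x)). split.
  - intros n. destruct (HB n) as [F [HF HBn]]. exists (fun k x => F k (f x)). split.
    + intros k. exact (open_preimage f _ Hf (HF k)).
    + intros x. apply HBn.
  - intros x. rewrite HX. apply HY.
Qed.

Lemma wadge_trans X Y Z : wadge_le X Y -> wadge_le Y Z -> wadge_le X Z.
Proof.
  intros [f [Hf HX]] [g [Hg HY]]. exists (fun x => g (f x)). split.
  - intros x n. destruct (Hg (f x) n) as [k Hk]. destruct (Hf x k) as [m Hm].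
    exists m. intros y Hy. apply Hk, N_restr. now apply Hm.
  - intros x. now rewrite HX.
Qed.

Lemma Pi03_closed_form X : Pi03 X -> exists F : nat -> nat -> cset,
  (forall n k, closed (F n k)) /\ forall x, X x <-> forall n, exists k, F n k x.
Proof.
  intros [B [HB HX]]. destruct (choose _ HB) as [F HF].
  exists F. split; [intros n; apply (HF n)|].
  intros x. rewrite HX. split; intros H n; now apply (proj2 (HF n)).
Qed.

(** * The complete [Pi03] set *)

(** Reading [a] at [to_nat (i, j)] as an entry of an infinite matrix, [row] gives the row index
    [i]; [P3] is the set of matrices with finitely many ones in each row. *)

Definition row (t : nat) : nat := fst (of_nat t).

Lemma row_le t : (row t <= t)%nat.
Proof.
  unfold row. pose proof (to_nat_non_decreasing (fst (of_nat t)) (snd (of_nat t))) as H.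
  rewrite <- surjective_pairing, cancel_to_of in H. lia.
Qed.

Lemma row_unbounded i m : exists t, (m <= t)%nat /\ row t = i.
Proof.
  exists (to_nat (i, m)). unfold row. rewrite cancel_of_to.
  pose proof (to_nat_non_decreasing i m). split; [lia|reflexivity].
Qed.

Definition P3 : cset :=
  fun a => forall i, exists T, forall t, (T <= t)%nat -> row t = i -> a t = false.

Lemma P3_rows_below a n :
  (forall i, (i < n)%nat -> exists T, forall t, (T <= t)%nat -> row t = i -> a t = false) ->
  exists T, forall t, (T <= t)%nat -> (row t < n)%nat -> a t = false.
Proof.
  intros H. destruct (uniform_bound (fun i t => row t = i -> a t = false) n H) as [T HT].
  exists T. intros t Ht Hr. exact (HT (row t) t Hr Ht eq_refl).
Qed.

(** Taking the least bad row matters: the rows before it die out, so from some stage on nothing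
    disturbs the levels up to it. *)
Lemma not_P3 a : ~ P3 a -> exists i,
  (exists T, forall t, (T <= t)%nat -> (row t < i)%nat -> a t = false) /\
  (forall T, exists t, (T <= t)%nat /\ row t = i /\ a t = true).
Proof.
  intros H. apply not_all_ex_not in H. destruct (least_nat _ H) as [i [Hi Hmin]].
  exists i. split.
  - apply P3_rows_below. intros j Hj. apply NNPP. exact (Hmin j Hj).
  - intros T. apply NNPP. intros Hno. apply Hi. exists T. intros t Ht Hr.
    destruct (a t) eqn:E; [|reflexivity]. exfalso. apply Hno. eauto.
Qed.

(** Row [n] of the code of [x] records the moments when [x] is seen to leave one more of the
    closed sets [F n 0], [F n 1], ... *)
Lemma Pi03_le_P3 X : Pi03 X -> wadge_le X P3.
Proof.
  intros HX. destruct (Pi03_closed_form X HX) as [F [HF HXF]].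
  (* The clause [k <= j] delays the [k]-th event to time [k] or later, so that events for
     unboundedly many [k] give infinitely many ones. *)
  set (missed := fun n k j x => (k <= j)%nat /\
    forall i, (i <= k)%nat -> forall y, N (restr x j) y -> ~ F n i y).
  set (change := fun x t => exists k,
    missed (row t) k (S (snd (of_nat t))) x /\ ~ missed (row t) k (snd (of_nat t)) x).
  assert (Hmono : forall n k j j' x, (j <= j')%nat -> missed n k j x -> missed n k j' x).
  { intros n k j j' x Hj [H1 H2]. split; [lia|]. intros i Hi y Hy. apply H2; [exact Hi|].
    apply N_prefix with (restr x j'); [now apply restr_split|exact Hy]. }
  exists (fun x t => if excluded_middle_informative (change x t) then true else false).
  split.
  - intros x n. exists (S n). intros y Hy i Hi. rewrite N_restr in Hy.
    assert (Hm : forall m k j, (j <= S i)%nat -> missed m k j y = missed m k j x).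
    { intros m k j Hj. unfold missed.
      assert (restr y j = restr x j) as ->; [|reflexivity].
      apply map_ext_in. intros l Hl. apply in_seq in Hl. apply Hy. lia. }
    assert (change y i = change x i) as ->; [|reflexivity].
    unfold change.
    assert (snd (of_nat i) <= i)%nat.
    { pose proof (to_nat_non_decreasing (fst (of_nat i)) (snd (of_nat i))) as H.
      rewrite <- surjective_pairing, cancel_to_of in H. lia. }
    apply propositional_extensionality.
    split; intros [k Hk]; exists k; rewrite !Hm in * by lia; exact Hk.
  - intros x. rewrite HXF. split.
    (* No index from [k0] on is ever missed, as [x] lies in [F n k0]; the finitely many events below
       [k0] are over by time [J]. *)
    + intros H n. destruct (H n) as [k0 Hk0].
      destruct (uniform_bound (fun k j => (exists j', missed n k j' x) -> missed n k j x) k0)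
        as [J HJ].
      { intros k _. destruct (classic (exists j', missed n k j' x)) as [[j' Hj']|Hno].
        - exists j'. intros t Ht _. exact (Hmono _ _ _ _ _ Ht Hj').
        - exists 0%nat. tauto. }
      destruct (uniform_bound (fun j t => row t = n -> snd (of_nat t) <> j) J) as [T HT].
      { intros j _. exists (S (to_nat (n, j))). intros t Ht Hr Hs.
        unfold row in Hr. rewrite <- Hr, <- Hs, <- surjective_pairing, cancel_to_of in Ht. lia. }
      exists T. intros t Ht Hr.
      destruct (excluded_middle_informative (change x t)) as [[k [Hk1 Hk2]]|]; [|reflexivity].
      exfalso. rewrite Hr in Hk1, Hk2. apply Hk2, HJ.
      * apply Nat.nle_gt. intros Hle. exact (proj2 Hk1 k0 Hle x (N_restr_self _ _) Hk0).
      * apply Nat.nlt_ge. intros Hlt. exact (HT _ t Hlt Ht Hr eq_refl).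
      * eauto.
    + intros H n. destruct (H n) as [T HT]. apply NNPP. intros Hno.
      (* The event for [S T] falls in a column not before [T], hence at a position where row [n]
         should already be zero. *)
      assert (Hex : exists j, missed n (S T) j x).
      { destruct (uniform_bound (fun i j => forall y, N (restr x j) y -> ~ F n i y) (S (S T)))
          as [J HJ].
        - intros i _. destruct (HF n i x) as [j Hj]; [intros Hx; apply Hno; eauto|].
          exists j. intros t Ht y Hy. apply Hj.
          apply N_prefix with (restr x t); [now apply restr_split|exact Hy].
        - exists (Nat.max J (S T)). split; [lia|].
          intros i Hi. apply HJ; lia. }
      destruct (least_nat _ Hex) as [[|j] [Hj Hmin]].
      { destruct Hj. lia. }
      assert (Hlow := proj1 Hj).
      assert (E : of_nat (to_nat (n, j)) = (n, j)) by apply cancel_of_to.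
      specialize (HT (to_nat (n, j))).
      pose proof (to_nat_non_decreasing n j). unfold row in HT. rewrite E in HT.
      specialize (HT ltac:(lia) eq_refl).
      destruct (excluded_middle_informative (change x (to_nat (n, j)))) as [|Hc];
        [discriminate|].
      apply Hc. exists (S T). unfold row. rewrite E. simpl.
      split; [exact Hj|]. apply Hmin. lia.
Qed.

(** Fix the rows below [n] after a finite string and let row [n] take infinitely many ones while
    entering all the open sets whose intersection is the [n]-th piece of a putative [Sigma03]
    decomposition; since that piece is inside [P3], this must fail at a finite stage. *)
Lemma P3_not_Sigma03 : ~ Sigma03 P3.
Proof.
  intros [H [HH HP]]. destruct (choose _ HH) as [O HO].
  set (frozen := fun n (p : list bool) (x : cantor) =>
    N p x /\ forall t, (length p <= t)%nat -> (row t < n)%nat -> x t = false).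
  set (fext := fun n (p q : list bool) => prefix p q /\ (length p < length q)%nat /\
    forall t, (length p <= t < length q)%nat -> (row t < n)%nat -> nth t q false = false).
  assert (Hlim : forall n q x, (forall j, fext n (q j) (q (S j))) -> (forall j, N (q j) x) ->
     forall t, (length (q 0%nat) <= t)%nat -> (row t < n)%nat -> x t = false).
  { intros n q x Hq Hx.
    assert (Hj : forall j t, (length (q 0%nat) <= t < length (q j))%nat -> (row t < n)%nat ->
      x t = false).
    { induction j as [|j IH]; intros t Ht Hr; [lia|].
      destruct (Nat.lt_ge_cases t (length (q j))) as [Hlt|Hge]; [apply IH; lia|].
      rewrite (Hx (S j) t) by lia. apply (Hq j); [lia|exact Hr]. }
    assert (Hl : forall j, (j <= length (q j))%nat).
    { induction j as [|j IH]; [lia|]. destruct (Hq j) as [_ [? _]]. lia. }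
    intros t Ht. apply (Hj (S t)). specialize (Hl (S t)). lia. }
  assert (Hclaim : forall n p, exists q, fext n p q /\
     forall x, frozen (S n) q x -> ~ H n x).
  { intros n p. apply NNPP. intros Hno.
    assert (Hmeet : forall q, fext n p q -> exists x, frozen (S n) q x /\ H n x).
    { intros q Hq. apply NNPP. intros Hc. apply Hno. exists q. split; [exact Hq|].
      intros x Hx Hn. apply Hc. eauto. }
    assert (Htr : forall u v w, fext n u v -> fext n v w -> fext n u w).
    { intros u v w [A1 [A2 A3]] [B1 [B2 B3]]. split; [eapply prefix_trans; eauto|].
      split; [lia|]. intros t Ht Hr.
      destruct (Nat.lt_ge_cases t (length v)) as [Hlt|Hge]; [|apply B3; [lia|exact Hr]].
      rewrite (prefix_nth v w) by assumption. apply A3; [lia|exact Hr]. }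
    assert (Hext : forall x q l, frozen (S n) q x ->
      exists r, fext n q r /\ prefix (restr x l) r /\
        exists t, (length q <= t < length r)%nat /\ row t = n /\ nth t r false = true).
    { intros x q l [Hqx Hfr]. destruct (row_unbounded n (Nat.max l (length q))) as [t [Ht Hr]].
      exists (restr x t ++ [true]). split; [split; [|split]|split].
      - apply prefix_trans with (restr x t); [|apply prefix_snoc].
        apply prefix_restr; [exact Hqx|lia].
      - rewrite length_app, length_restr. simpl. lia.
      - intros u Hu Hru. rewrite length_app, length_restr in Hu. simpl in Hu.
        assert (u < t)%nat by (destruct (Nat.eq_dec u t) as [->|]; lia).
        rewrite app_nth1 by (rewrite length_restr; lia).
        rewrite nth_restr by lia. apply Hfr; lia.
      - apply prefix_trans with (restr x t); [apply restr_split; lia|apply prefix_snoc].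
      - exists t. rewrite length_app, length_restr. simpl.
        split; [lia|split; [exact Hr|]].
        rewrite app_nth2 by (rewrite length_restr; lia).
        now rewrite length_restr, Nat.sub_diag. }
    assert (Hp0 : exists q0, fext n p q0).
    { exists (p ++ [false]). split; [apply prefix_snoc|]. rewrite length_app. simpl.
      split; [lia|]. intros t Ht _. replace t with (length p) by lia. apply nth_middle. }
    destruct Hp0 as [q0 Hq0].
    assert (Hstep : forall a : nat * list bool, exists r, fext n p (snd a) ->
      fext n (snd a) r /\ (forall y, N r y -> O n (fst a) y) /\
      exists t, (length (snd a) <= t < length r)%nat /\ row t = n /\ nth t r false = true).
    { intros [j q]. simpl. destruct (classic (fext n p q)) as [Hq|Hq]; [|now exists []].
      destruct (Hmeet q Hq) as [x [Hx Hn]].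
      destruct (HO n) as [HOo HOe]. destruct (HOo j x) as [l Hl]; [now apply HOe|].
      destruct (Hext x q l Hx) as [r [H1 [H2 H3]]]. exists r. intros _.
      split; [exact H1|split; [|exact H3]]. intros y Hy. apply Hl.
      now apply N_prefix with r. }
    destruct (choose _ Hstep) as [g Hg].
    set (q := fix q j := match j with 0%nat => q0 | S j => g (j, q j) end).
    assert (Hq : forall j, fext n p (q j)).
    { induction j as [|j IH]; [exact Hq0|].
      apply Htr with (q j); [exact IH|]. exact (proj1 (Hg (j, q j) IH)). }
    assert (Hqs : forall j, fext n (q j) (q (S j))).
    { intros j. exact (proj1 (Hg (j, q j) (Hq j))). }
    destruct (chain_limit q) as [x Hx].
    { intros j. destruct (Hqs j) as [? [? _]]. now split. }
    assert (HPx : P3 x).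
    { apply HP. exists n. apply (proj2 (HO n)). intros j.
      exact (proj1 (proj2 (Hg (j, q j) (Hq j))) x (Hx (S j))). }
    destruct (HPx n) as [T HT].
    assert (Hl : forall j, (j <= length (q j))%nat).
    { induction j as [|j IH]; [lia|]. destruct (Hqs j) as [_ [? _]]. lia. }
    destruct (proj2 (proj2 (Hg (T, q T) (Hq T)))) as [t [Ht [Hr Htrue]]].
    simpl in Ht. specialize (Hl T).
    specialize (HT t ltac:(lia) Hr). rewrite (Hx (S T) t) in HT by (simpl; lia).
    simpl in HT. congruence. }
  destruct (choose (fun a q => fext (fst a) (snd a) q /\
     forall x, frozen (S (fst a)) q x -> ~ H (fst a) x)) as [g Hg].
  { intros [n p]. apply Hclaim. }
  set (q := fix q n := match n with 0%nat => [] | S n => g (n, q n) end).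
  assert (Hq : forall n, fext n (q n) (q (S n))) by (intros n; apply (Hg (n, q n))).
  destruct (chain_limit q) as [x Hx].
  { intros n. destruct (Hq n) as [? [? _]]. now split. }
  assert (Hfr : forall n t, (length (q n) <= t)%nat -> (row t < n)%nat -> x t = false).
  { intros n t Ht Hr. apply (Hlim n (fun j => q (n + j)%nat) x).
    - intros j. replace (n + S j)%nat with (S (n + j)) by lia.
      destruct (Hq (n + j)%nat) as [H1 [H2 H3]]. split; [exact H1|split; [exact H2|]].
      intros u Hu Hru. apply H3; [exact Hu|lia].
    - intros j. apply Hx.
    - now rewrite Nat.add_0_r.
    - exact Hr. }
  assert (HPx : P3 x).
  { intros i. exists (length (q (S i))). intros t Ht Hr. apply (Hfr (S i)); lia. }
  apply HP in HPx. destruct HPx as [n Hn]. revert Hn.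
  apply (Hg (n, q n)). split; [apply (Hx (S n))|]. apply (Hfr (S n)).
Qed.

(** * A [Pi03] set that is not [Sigma03] is complete *)

(** Call [Z] coverable if it lies in a [Sigma02] set [E] with [X /\ E] in [Sigma03].  If every
    [G m := ~ (exists k, F m k)] were coverable inside [C], by [E m] say, then [C] minus all the
    [E m] would be a [Pi02] subset of [X], and [X /\ C] would be [Sigma03].  For an [m] that
    fails, [D] is the closure of what remains of [G m] after removing the basic open sets on
    which it is coverable. *)
Lemma Pi02_kernel (X C : cset) (F : nat -> nat -> cset) :
  (forall n k, closed (F n k)) -> (forall x, X x <-> forall n, exists k, F n k x) ->
  closed C -> ~ Sigma03 (fun x => X x /\ C x) ->
  exists D m, closed D /\ (forall x, D x -> C x) /\ (exists x, D x) /\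
    forall s, (exists x, D x /\ N s x) ->
      (exists x, D x /\ N s x /\ forall k, ~ F m k x) /\
      ~ Sigma03 (fun x => X x /\ D x /\ N s x).
Proof.
  intros HF HX HC HS.
  set (coverable := fun Z : cset => exists E, Sigma02 E /\ (forall x, Z x -> E x) /\
     Sigma03 (fun x => (X x /\ C x) /\ E x)).
  set (G := fun m x => C x /\ forall k, ~ F m k x).
  assert (Hm : exists m, ~ coverable (G m)).
  { apply NNPP. intros Hno. apply HS.
    assert (Hall : forall m, coverable (G m)).
    { intros m. apply NNPP. intros H. apply Hno. now exists m. }
    destruct (choose _ Hall) as [E HE].
    replace (fun x => X x /\ C x) with
      (fun x => (exists m, (X x /\ C x) /\ E m x) \/ (C x /\ ~ exists m, E m x)).
    - apply Sigma03_union2.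
      + apply Sigma03_union. intros m. apply (HE m).
      + apply Pi02_Sigma03, Pi02_inter2; [now apply closed_Pi02|].
        apply Pi02_not_Sigma02, Sigma02_union. intros m. apply (HE m).
    - apply cset_ext. intros x. split.
      + intros [[m [H _]]|[HCx Hn]]; [exact H|]. split; [|exact HCx].
        apply HX. intros m. apply NNPP. intros Hk. apply Hn. exists m. apply (HE m).
        split; [exact HCx|]. intros k Hk'. apply Hk. now exists k.
      + intros H. destruct (classic (exists m, E m x)) as [[m Hm]|Hn].
        * left. now exists m.
        * right. split; [apply H|exact Hn]. }
  destruct Hm as [m Hm].
  set (small := fun s => coverable (fun x => G m x /\ N s x)).
  set (V := fun x => exists s, small s /\ N s x).
  assert (HV : coverable (fun x => G m x /\ V x)).
  { destruct strings_countable as [e He].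
    destruct (choose (fun n E => Sigma02 E /\ (small (e n) -> forall x, G m x /\ N (e n) x -> E x)
       /\ Sigma03 (fun x => (X x /\ C x) /\ E x))) as [E HE].
    { intros n. destruct (classic (small (e n))) as [[E [H1 [H2 H3]]]|Hn].
      - exists E. auto.
      - exists (fun _ => False). split; [apply closed_Sigma02, closed_empty|].
        split; [tauto|]. replace (fun x => _ /\ False) with (fun _ : cantor => False).
        + apply Sigma03_empty.
        + apply cset_ext. tauto. }
    exists (fun x => exists n, E n x). split; [|split].
    - apply Sigma02_union. intros n. apply (HE n).
    - intros x [Hx [s [Hs Hsx]]]. destruct (He s) as [n <-]. exists n.
      apply (HE n); [exact Hs|now split].
    - replace (fun x => (X x /\ C x) /\ exists n, E n x) with
        (fun x => exists n, (X x /\ C x) /\ E n x).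
      + apply Sigma03_union. intros n. apply (HE n).
      + apply cset_ext. intros x. firstorder. }
  set (R := fun x => G m x /\ ~ V x).
  exists (fun x => forall n, exists y, N (restr x n) y /\ R y), m.
  assert (HRD : forall x, R x -> forall n, exists y, N (restr x n) y /\ R y).
  { intros x Hx n. exists x. split; [apply N_restr_self|exact Hx]. }
  split; [apply closed_adherence|split; [|split]].
  - intros x Hx. apply closed_approx; [exact HC|]. intros n.
    destruct (Hx n) as [y [Hy [[Hc _] _]]]. eauto.
  - apply NNPP. intros Hno. apply Hm. destruct HV as [E [H1 [H2 H3]]].
    exists E. split; [exact H1|split; [|exact H3]]. intros x Hx. apply H2.
    split; [exact Hx|]. apply NNPP. intros HVx. apply Hno. exists x. apply HRD. now split.
  - intros s [x [Hx Hsx]].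
    destruct (Hx (length s)) as [y [Hy HRy]]. rewrite (restr_N s x Hsx) in Hy.
    split; [exists y; split; [exact (HRD y HRy)|split; [exact Hy|apply HRy]]|].
    intros HSig. apply (proj2 HRy). exists s. split; [|exact Hy].
    destruct HV as [E [H1 [H2 H3]]].
    set (D := fun x => forall n, exists y, N (restr x n) y /\ R y) in *.
    (* If [X] were [Sigma03] on [D /\ N s], adding this closed set to the cover of [V] would make
       [s] small, although [y] lies in no small cylinder. *)
    exists (fun z => E z \/ (D z /\ N s z)). split; [|split].
    + apply Sigma02_union2; [exact H1|]. apply closed_Sigma02, closed_inter.
      * apply closed_adherence.
      * apply closed_N.
    + intros z [Hz Hsz]. destruct (classic (V z)) as [HVz|HVz]; [left; now apply H2|].
      right. split; [exact (HRD z (conj Hz HVz))|exact Hsz].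
    + replace (fun z => (X z /\ C z) /\ (E z \/ D z /\ N s z)) with
        (fun z => ((X z /\ C z) /\ E z) \/ (X z /\ D z /\ N s z)).
      * now apply Sigma03_union2.
      * apply cset_ext. intros z. split; [|tauto].
        intros [H|[HXz [HDz Hsz]]]; [tauto|].
        split; [|tauto]. split; [exact HXz|]. apply closed_approx; [exact HC|]. intros n.
        destruct (HDz n) as [w [Hw [[Hc _] _]]]. eauto.
Qed.

(** The state is a string together with decreasing closed sets [D 0], [D 1], ... all meeting it.
    Passing to [D (S i)] puts the limit in some [F i k]; a one in row [i] forces the string
    further into [G (m i)], which is dense in [D i], and renews the closed sets above level
    [i]. *)
Lemma P3_le_proper_Pi03 X : Pi03 X -> ~ Sigma03 X -> wadge_le P3 X.
Proof.
  intros HPi HSig. destruct (Pi03_closed_form X HPi) as [F [HF HX]].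
  (* Both properties are asked in every cylinder meeting [D], since the tower above a level has to
     be rebuilt inside whatever string has been reached. *)
  set (lev := fun (D : cset) m => closed D /\ forall s, (exists x, D x /\ N s x) ->
      (exists x, D x /\ N s x /\ forall k, ~ F m k x) /\
      ~ Sigma03 (fun x => X x /\ D x /\ N s x)).
  set (St := (list bool * ((nat -> cset) * (nat -> nat)))%type).
  set (Inv := fun t (st : St) => let '(y, (D, m)) := st in
     (forall i, (i <= t)%nat -> lev (D i) (m i)) /\
     (forall i, (i < t)%nat -> (exists k, forall x, D (S i) x -> F i k x) /\
                               (forall x, D (S i) x -> D i x)) /\
     (exists x, D t x /\ N y x)).
  assert (Hadd : forall i D m y, lev D m -> (exists x, D x /\ N y x) ->
     exists D' m', lev D' m' /\ (forall x, D' x -> D x) /\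
       (exists k, forall x, D' x -> F i k x) /\ exists x, D' x /\ N y x).
  { intros i D m y [HD1 HD2] Hy. destruct (HD2 y Hy) as [_ HS].
    (* [X] on [D /\ N y] is the union of its traces on the [F i k], so one trace is not [Sigma03],
       and it has a kernel. *)
    assert (Hk : exists k, ~ Sigma03 (fun x => X x /\ (D x /\ N y x) /\ F i k x)).
    { apply NNPP. intros Hno. apply HS.
      replace (fun x => X x /\ D x /\ N y x) with
        (fun x => exists k, X x /\ (D x /\ N y x) /\ F i k x).
      - apply Sigma03_union. intros k. apply NNPP. intros Hc. apply Hno. now exists k.
      - apply cset_ext. intros x. split; [firstorder|].
        intros [H1 H2]. destruct (proj1 (HX x) H1 i) as [k Hk]. now exists k. }
    destruct Hk as [k Hk].
    destruct (Pi02_kernel X (fun x => (D x /\ N y x) /\ F i k x) F HF HX) as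
      [D' [m' [A1 [A2 [[x A3] A4]]]]]; [|exact Hk|].
    - apply closed_inter; [apply closed_inter; [exact HD1|apply closed_N]|apply HF].
    - exists D', m'. split; [now split|]. split; [|split].
      + intros z Hz. apply (A2 z Hz).
      + exists k. intros z Hz. apply (A2 z Hz).
      + exists x. split; [exact A3|apply (A2 x A3)]. }
  assert (Hgrow : forall i y D m, Inv i (y, (D, m)) -> forall n, (i <= n)%nat ->
     exists D' m', Inv n (y, (D', m')) /\ forall j, (j <= i)%nat -> D' j = D j /\ m' j = m j).
  { intros i y D m Hi n Hn. induction Hn as [|n Hn IH].
    { exists D, m. auto. }
    destruct IH as [D1 [m1 [[I1 [I2 I3]] Hsame]]].
    destruct (Hadd n (D1 n) (m1 n) y) as [D2 [m2 [A1 [A2 [A3 A4]]]]];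
      [now apply I1|exact I3|].
    exists (fun j => if Nat.eq_dec j (S n) then D2 else D1 j),
           (fun j => if Nat.eq_dec j (S n) then m2 else m1 j).
    split; [split; [|split]|].
    - intros j Hj. destruct (Nat.eq_dec j (S n)); [exact A1|]. apply I1. lia.
    - intros j Hj. destruct (Nat.eq_dec j (S n)); [lia|].
      destruct (Nat.eq_dec (S j) (S n)) as [E|].
      + injection E as ->. now split.
      + apply I2. lia.
    - destruct (Nat.eq_dec (S n) (S n)); [exact A4|lia].
    - intros j Hj. destruct (Nat.eq_dec j (S n)); [lia|]. now apply Hsame. }
  set (Rel := fun t (b : bool) (st st' : St) =>
     let '(y, (D, m)) := st in let '(y', (D', m')) := st' in
     (forall j, (j <= if b then row t else t)%nat -> D' j = D j /\ m' j = m j) /\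
     (b = true -> forall k z, (k <= t)%nat -> N y' z -> ~ F (m (row t)) k z)).
  destruct (Pi02_kernel X (fun _ => True) F HF HX) as [D0 [m0 [A1 [_ [[x0 A3] A4]]]]].
  { intros x []. exact I. }
  { replace (fun x => X x /\ True) with X; [exact HSig|]. apply cset_ext. tauto. }
  destruct (transducer St fst Inv Rel ([], (fun _ => D0, fun _ => m0))) as [f [Hf Hrun]].
  - split; [|split].
    + intros i _. now split.
    + intros i Hi. lia.
    + exists x0. split; [exact A3|]. intros i Hi. simpl in Hi. lia.
  - intros t b [y [D m]] [I1 [I2 [x [Hx Hyx]]]].
    assert (Hnest : forall i j, (i <= j)%nat -> (j <= t)%nat -> forall z, D j z -> D i z).
    { intros i j Hij. induction Hij as [|j Hij IH]; [auto|].
      intros Hj z Hz. apply IH; [lia|]. now apply (I2 j ltac:(lia)). }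
    (* The highest level kept at this stage; the new string must still meet its closed set. *)
    set (i := if b then row t else t).
    assert (Hit : (i <= t)%nat) by (unfold i; destruct b; [apply row_le|lia]).
    assert (Hy' : exists y', prefix y y' /\ (length y < length y')%nat /\
       (exists x, D i x /\ N y' x) /\
       (b = true -> forall k z, (k <= t)%nat -> N y' z -> ~ F (m (row t)) k z)).
    { destruct (proj2 (I1 i Hit) y) as [[z [Hz1 [Hz2 Hz3]]] _].
      { exists x. split; [now apply (Hnest i t)|exact Hyx]. }
      destruct (uniform_bound (fun k n => forall w, N (restr z n) w -> ~ F (m i) k w) (S t))
        as [n Hn].
      { intros k _. destruct (HF (m i) k z (Hz3 k)) as [n Hn]. exists n.
        intros l Hl w Hw. apply Hn. apply N_prefix with (restr z l); [|exact Hw].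
        now apply restr_split. }
      exists (restr z (Nat.max n (S (length y)))). split; [|split; [|split]].
      - apply prefix_restr; [exact Hz2|lia].
      - rewrite length_restr. lia.
      - exists z. split; [exact Hz1|apply N_restr_self].
      - intros -> k w Hk Hw. apply (Hn k (Nat.max n (S (length y)))); [lia|lia|exact Hw]. }
    destruct Hy' as [y' [B1 [B2 [B3 B4]]]].
    destruct (Hgrow i y' D m) with (n := S t) as [D' [m' [C1 C2]]].
    + split; [|split; [|exact B3]]; intros j Hj; [apply I1|apply I2]; lia.
    + lia.
    + exists (y', (D', m')). split; [exact C1|]. split; [|now split].
      split; [exact C2|exact B4].
  - exists f. split; [exact Hf|]. intros a. destruct (Hrun a) as [run Hr].
    assert (Hstable : forall n T, (n <= T)%nat ->
      (forall t, (T <= t)%nat -> (row t < n)%nat -> a t = false) ->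
      forall t, (T <= t)%nat -> fst (snd (run t)) n = fst (snd (run T)) n /\
         snd (snd (run t)) n = snd (snd (run T)) n).
    { intros n T HnT HT t Ht. induction Ht as [|t Ht IH]; [now split|].
      destruct (Hr t) as [_ [HR _]]. destruct IH as [<- <-].
      destruct (run t) as [y [D m]], (run (S t)) as [y' [D' m']]. simpl.
      apply (proj1 HR). destruct (a t) eqn:E; [|lia].
      apply Nat.nlt_ge. intros Hlt. rewrite (HT t Ht Hlt) in E. discriminate. }
    (* Once level [n] is stable, [D n] contains the later sets [D t] and so meets all later strings;
       being closed, it contains the limit. *)
    assert (Hin : forall n T, (n <= T)%nat ->
      (forall t, (T <= t)%nat -> (row t < n)%nat -> a t = false) ->
      fst (snd (run T)) n (f a)).
    { intros n T HnT HT. apply closed_approx.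
      - destruct (Hr T) as [HI _]. destruct (run T) as [y [D m]]. now apply (proj1 HI n).
      - intros l. set (t := Nat.max T l).
        destruct (Hr t) as [HI [_ [_ [Hl HN]]]].
        rewrite <- (proj1 (Hstable n T HnT HT t ltac:(lia))).
        destruct (run t) as [y [D m]]. simpl in *. destruct HI as [_ [I2 [x [Hx Hyx]]]].
        exists x. split.
        + apply N_prefix with y; [|exact Hyx]. apply N_comparable with (f a).
          * apply N_restr_self.
          * exact HN.
          * rewrite length_restr. lia.
        + assert (Hnest : forall j, (n <= j)%nat -> (j <= t)%nat -> forall z, D j z -> D n z).
          { intros j Hij. induction Hij as [|j Hij IH]; [auto|].
            intros Hj z Hz. apply IH; [lia|]. now apply (I2 j ltac:(lia)). }
          apply (Hnest t); [lia|lia|exact Hx]. }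
    split.
    + intros HP. apply HX. intros n.
      destruct (P3_rows_below a (S n)) as [T HT]; [intros i _; apply HP|].
      assert (Hd := Hin (S n) (Nat.max (S n) T) ltac:(lia)
        ltac:(intros t Ht; apply HT; lia)).
      destruct (Hr (Nat.max (S n) T)) as [HI _].
      destruct (run (Nat.max (S n) T)) as [y [D m]]. simpl in Hd.
      destruct HI as [_ [I2 _]]. destruct (I2 n ltac:(lia)) as [[k Hk] _].
      exists k. now apply Hk.
    + intros HXf. apply NNPP. intros HnP. destruct (not_P3 a HnP) as [i [[T HT] Hinf]].
      set (T' := Nat.max i T).
      destruct (proj1 (HX (f a)) HXf (snd (snd (run T')) i)) as [k Hk]. revert Hk.
      (* Row [i] has a one after stage [k], and there the output leaves [F (m i) k], with [m i]
         already final. *)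
      destruct (Hinf (Nat.max T' k)) as [t [Ht [Hrow Hat]]].
      destruct (Hstable i T' ltac:(lia) ltac:(intros; apply HT; lia) t ltac:(lia)) as [_ <-].
      destruct (Hr t) as [_ [HR _]]. destruct (Hr (S t)) as [_ [_ [_ [_ HN]]]].
      rewrite Hat in HR.
      destruct (run t) as [y [D m]], (run (S t)) as [y' [D' m']]. simpl in *.
      rewrite <- Hrow. apply (proj2 HR eq_refl); [lia|exact HN].
Qed.

(** * Outer measure *)

Lemma half_pow_pos n : 0 < (/ 2) ^ n.
Proof. apply pow_lt. lra. Qed.

Lemma half_pow_small e : 0 < e -> exists n, (/ 2) ^ n < e.
Proof.
  intros He. destruct (pow_lt_1_zero (/ 2)) with (y := e) as [n Hn]; [|exact He|].
  - rewrite Rabs_pos_eq; lra.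
  - exists n. specialize (Hn n (le_n n)).
    rewrite Rabs_pos_eq in Hn; [exact Hn|apply Rlt_le, half_pow_pos].
Qed.

Lemma half_pow_le_1 n : (/ 2) ^ n <= 1.
Proof. induction n as [|n IH]; simpl; [lra|]. pose proof (half_pow_pos n). lra. Qed.

Lemma sum_half_pow e n : 0 <= e -> sum_f_R0 (fun k => e * (/ 2) ^ (S k)) n <= e.
Proof.
  intros He.
  assert (H : sum_f_R0 (fun k => e * (/ 2) ^ (S k)) n = e - e * (/ 2) ^ (S n)).
  { induction n as [|n IH]; simpl in *; [lra|]. rewrite IH. lra. }
  rewrite H. pose proof (Rmult_le_pos e ((/ 2) ^ S n) He (Rlt_le _ _ (half_pow_pos _))). lra.
Qed.

Lemma sum_nonneg_mono (a : nat -> R) m n :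
  (forall k, 0 <= a k) -> (m <= n)%nat -> sum_f_R0 a m <= sum_f_R0 a n.
Proof.
  intros Ha H. induction H as [|n H IH]; [lra|]. simpl. specialize (Ha (S n)). lra.
Qed.

Lemma sum_nonneg_term (a : nat -> R) n : (forall k, 0 <= a k) -> a n <= sum_f_R0 a n.
Proof.
  intros Ha. destruct n as [|n]; simpl; [lra|].
  pose proof (cond_pos_sum a n Ha). lra.
Qed.

Definition lsum {T : Type} (f : T -> R) (l : list T) : R :=
  fold_right (fun x r => f x + r) 0 l.

Lemma lsum_app {T} (f : T -> R) l l' : lsum f (l ++ l') = lsum f l + lsum f l'.
Proof. induction l as [|x l IH]; simpl; [lra|]. rewrite IH. lra. Qed.

Lemma lsum_map {T U} (g : T -> U) (f : U -> R) l :
  lsum f (map g l) = lsum (fun x => f (g x)) l.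
Proof. induction l as [|x l IH]; simpl; [reflexivity|]. now rewrite IH. Qed.

Lemma sum_lsum f n : sum_f_R0 f n = lsum f (seq 0 (S n)).
Proof.
  induction n as [|n IH]; [simpl; lra|].
  rewrite seq_S, lsum_app, <- IH. simpl. lra.
Qed.

Lemma lsum_incl {T} (f : T -> R) l l' :
  (forall x, 0 <= f x) -> NoDup l -> incl l l' -> lsum f l <= lsum f l'.
Proof.
  intros Hf Hl. revert l'. induction Hl as [|x l Hx Hl IH]; intros l' Hi.
  - clear Hi. induction l' as [|y l' IH]; simpl; [lra|]. specialize (Hf y). simpl in IH. lra.
  - destruct (in_split x l') as [l1 [l2 ->]]; [apply Hi; now left|].
    assert (H : lsum f l <= lsum f (l1 ++ l2)).
    { apply IH. intros y Hy.
      assert (Hin : In y (l1 ++ x :: l2)) by (apply Hi; now right).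
      apply in_or_app. apply in_app_or in Hin. destruct Hin as [H|[<-|H]]; [auto| |auto].
      contradiction. }
    rewrite lsum_app in *. simpl. lra.
Qed.

(** Both coordinates of a pair are bounded by its code, so the pairs coded up to [n] lie in the
    square of side [S n]. *)
Lemma sum_pairs (f : nat -> nat -> R) n : (forall i j, 0 <= f i j) ->
  sum_f_R0 (fun k => f (fst (of_nat k)) (snd (of_nat k))) n <=
  sum_f_R0 (fun i => sum_f_R0 (f i) n) n.
Proof.
  intros Hf. rewrite !sum_lsum.
  set (g := fun p : nat * nat => f (fst p) (snd p)).
  assert (E : forall l, lsum (fun i => sum_f_R0 (f i) n) l =
                        lsum g (list_prod l (seq 0 (S n)))).
  { intros l. induction l as [|i l IH]; [reflexivity|].
    change (sum_f_R0 (f i) n + lsum (fun i => sum_f_R0 (f i) n) l =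
      lsum g (map (fun j => (i, j)) (seq 0 (S n)) ++ list_prod l (seq 0 (S n)))).
    rewrite lsum_app, lsum_map, <- IH. f_equal. apply sum_lsum. }
  rewrite E. rewrite <- (lsum_map of_nat g). apply lsum_incl.
  - intros p. apply Hf.
  - apply FinFun.Injective_map_NoDup; [|apply seq_NoDup].
    intros a b Hab. rewrite <- (cancel_to_of a), Hab. apply cancel_to_of.
  - intros [i j] Hin. apply in_map_iff in Hin. destruct Hin as [k [Hk Hin]].
    apply in_seq in Hin. pose proof (cancel_to_of k) as Hc. rewrite Hk in Hc.
    pose proof (to_nat_non_decreasing i j).
    apply in_prod; apply in_seq; lia.
Qed.

(** * Weights of cylinders, covers and the function [mu] *)

Lemma muN_pos s : 0 < muN s.
Proof. apply half_pow_pos. Qed.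

Lemma muN_snoc s b : muN (s ++ [b]) = muN s / 2.
Proof. unfold muN. rewrite length_app. simpl. rewrite Nat.add_1_r. simpl. lra. Qed.

Lemma muN_prefix s u : prefix s u -> muN u <= muN s.
Proof.
  intros [v ->]. unfold muN. rewrite length_app, pow_add.
  pose proof (half_pow_le_1 (length v)). pose proof (half_pow_pos (length s)). nra.
Qed.

Definition wt (o : option (list bool)) : R :=
  match o with None => 0 | Some s => muN s end.

Lemma wt_nonneg o : 0 <= wt o.
Proof. destruct o as [s|]; simpl; [apply Rlt_le, muN_pos|lra]. Qed.

(** Covers by at most countably many cylinders; [covers_le] demands infinitely many. *)
Definition cov (A : cset) (r : R) : Prop :=
  exists s : nat -> option (list bool),
    (forall x, A x -> exists k u, s k = Some u /\ N u x) /\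
    (forall n, sum_f_R0 (fun k => wt (s k)) n <= r).

Lemma covers_le_cov A r : covers_le A r -> cov A r.
Proof.
  intros [s [H1 H2]]. exists (fun k => Some (s k)). split; [|exact H2].
  intros x Hx. destruct (H1 x Hx) as [k Hk]. eauto.
Qed.

Lemma cov_covers_le A r e : 0 < e -> cov A r -> covers_le A (r + e).
Proof.
  intros He [s [H1 H2]]. destruct (half_pow_small e He) as [c Hc].
  exists (fun k => match s k with Some u => u | None => repeat false (S k + c) end). split.
  - intros x Hx. destruct (H1 x Hx) as [k [u [Hk Hu]]]. exists k. now rewrite Hk.
  - intros n. apply Rle_trans with
      (sum_f_R0 (fun k => wt (s k) + (/ 2) ^ c * (/ 2) ^ S k) n).
    + apply sum_Rle. intros k _. pose proof (half_pow_pos c). pose proof (half_pow_pos (S k)).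
      destruct (s k) as [u|]; simpl wt; [nra|].
      unfold muN. rewrite repeat_length, pow_add. lra.
    + rewrite sum_plus. specialize (H2 n).
      pose proof (sum_half_pow ((/ 2) ^ c) n (Rlt_le _ _ (half_pow_pos c))). lra.
Qed.

Lemma outer_exists A : exists m, outer A m.
Proof.
  set (E := fun r => covers_le A (- r)).
  destruct (completeness E) as [m [H1 H2]].
  - exists 0. intros r [s [_ Hs]]. specialize (Hs 0%nat). simpl in Hs.
    pose proof (muN_pos (s 0%nat)). lra.
  - exists (- (0 + 2)). unfold E. rewrite Ropp_involutive.
    replace (0 + 2) with (1 + 1) by lra. apply cov_covers_le; [lra|].
    exists (fun k => match k with 0%nat => Some [] | _ => None end). split.
    + intros x _. exists 0%nat, []. split; [reflexivity|]. intros i Hi. simpl in Hi. lia.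
    + intros n. apply Req_le. induction n as [|n IH]; simpl in *; [unfold muN; simpl; lra|].
      rewrite IH. lra.
  - exists (- m). split.
    + intros r Hr. assert (- r <= m); [|lra]. apply H1. unfold E. now rewrite Ropp_involutive.
    + intros b Hb. assert (m <= - b); [|lra]. apply H2. intros r Hr. specialize (Hb _ Hr). lra.
Qed.

Definition mu (A : cset) : R := epsilon (inhabits 0) (outer A).

Lemma outer_mu A : outer A (mu A).
Proof. exact (epsilon_spec (inhabits 0) (outer A) (outer_exists A)). Qed.

Lemma outer_iff A m : outer A m <-> m = mu A.
Proof.
  split; [|intros ->; apply outer_mu].
  intros [H1 H2]. destruct (outer_mu A) as [H3 H4].
  apply Rle_antisym; [now apply H4|now apply H2].
Qed.

Lemma mu_le_cov A r : cov A r -> mu A <= r.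
Proof.
  intros H. apply le_epsilon. intros e He.
  apply (proj1 (outer_mu A)). now apply cov_covers_le.
Qed.

Lemma mu_lt_cov A r : mu A < r -> cov A r.
Proof.
  intros H. apply NNPP. intros Hno. apply (Rlt_not_le _ _ H).
  apply (proj2 (outer_mu A)). intros b Hb. apply Rnot_lt_le. intros Hbr. apply Hno.
  destruct (covers_le_cov _ _ Hb) as [s [H1 H2]]. exists s. split; [exact H1|].
  intros n. specialize (H2 n). lra.
Qed.

Lemma mu_nonneg A : 0 <= mu A.
Proof.
  apply (proj2 (outer_mu A)). intros r [s [_ Hs]]. specialize (Hs 0%nat). simpl in Hs.
  pose proof (muN_pos (s 0%nat)). lra.
Qed.

Lemma mu_mono (A B : cset) : (forall x, A x -> B x) -> mu A <= mu B.
Proof.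
  intros H. apply le_epsilon. intros e He. apply mu_le_cov.
  destruct (mu_lt_cov B (mu B + e)) as [s [H1 H2]]; [lra|].
  exists s. split; [|exact H2]. intros x Hx. apply H1. auto.
Qed.

Lemma mu_cyl s : mu (N s) <= muN s.
Proof.
  apply mu_le_cov. exists (fun k => match k with 0%nat => Some s | _ => None end). split.
  - intros x Hx. now exists 0%nat, s.
  - intros n. apply Req_le. induction n as [|n IH]; simpl in *; lra.
Qed.

(** Cover the [n]-th piece with excess [e / 2^(n+1)]. The bounds [a] on the pieces and [r] on the
    partial sums stand in for an infinite series. *)
Lemma mu_countable_union (A : nat -> cset) (a : nat -> R) (r : R) :
  (forall n, mu (A n) <= a n) -> (forall n, sum_f_R0 a n <= r) ->
  mu (fun x => exists n, A n x) <= r.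
Proof.
  intros HA Ha. apply le_epsilon. intros e He. apply mu_le_cov.
  destruct (choose (fun n (s : nat -> option (list bool)) =>
    (forall x, A n x -> exists k u, s k = Some u /\ N u x) /\
    (forall m, sum_f_R0 (fun k => wt (s k)) m <= a n + e * (/ 2) ^ S n))) as [s Hs].
  { intros n. apply (mu_lt_cov (A n)). specialize (HA n).
    pose proof (Rmult_lt_0_compat _ _ He (half_pow_pos (S n))). lra. }
  exists (fun k => s (fst (of_nat k)) (snd (of_nat k))). split.
  - intros x [n Hx]. destruct (proj1 (Hs n) x Hx) as [k [u [Hk Hu]]].
    exists (to_nat (n, k)), u. rewrite cancel_of_to. now split.
  - intros n. eapply Rle_trans.
    { apply (sum_pairs (fun i j => wt (s i j))). intros. apply wt_nonneg. }
    apply Rle_trans with (sum_f_R0 (fun k => a k + e * (/ 2) ^ S k) n).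
    + apply sum_Rle. intros k _. apply (Hs k).
    + rewrite sum_plus. pose proof (sum_half_pow e n (Rlt_le _ _ He)). specialize (Ha n). lra.
Qed.

Lemma mu_empty (A : cset) : (forall x, ~ A x) -> mu A = 0.
Proof.
  intros H. apply Rle_antisym; [|apply mu_nonneg]. apply mu_le_cov.
  exists (fun _ => None). split; [intros x Hx; now destruct (H x)|].
  intros n. apply Req_le. induction n as [|n IH]; simpl in *; lra.
Qed.

Lemma mu_union (A B C : cset) : (forall x, C x -> A x \/ B x) -> mu C <= mu A + mu B.
Proof.
  intros H.
  apply Rle_trans with (mu (fun x => exists n : nat,
    (match n with 0%nat => A | 1%nat => B | _ => fun _ => False end) x)).
  - apply mu_mono. intros x Hx. destruct (H x Hx); [now exists 0%nat|now exists 1%nat].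
  - apply mu_countable_union with
      (a := fun n => match n with 0%nat => mu A | 1%nat => mu B | _ => 0 end).
    + intros [|[|n]]; [apply Rle_refl|apply Rle_refl|]. apply Req_le, mu_empty. tauto.
    + pose proof (mu_nonneg A). pose proof (mu_nonneg B).
      intros [|n]; [simpl; lra|]. apply Req_le.
      induction n as [|n IH]; simpl in *; [lra|]. rewrite IH. lra.
Qed.

(** * Measurability of cylinders *)

Definition shift (b : bool) (E : cset) : cset :=
  fun y => E (fun i => match i with 0%nat => b | S i => y i end).

(** The trace of a cylinder on the half [x 0 = b] of the space, rescaled. *)
Definition tail (b : bool) (o : option (list bool)) : option (list bool) :=
  match o with
  | None => None
  | Some [] => Some []
  | Some (c :: s) => if Bool.eqb c b then Some s else None
  end.

(** A cylinder inside one half doubles when that half is rescaled; the whole space counts fully in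
    both. *)
Lemma wt_tail o : wt (tail false o) + wt (tail true o) = 2 * wt o.
Proof. destruct o as [[|[|] s]|]; unfold wt, muN; simpl; lra. Qed.

Lemma tail_cover b (E : cset) (s : nat -> option (list bool)) :
  (forall x, E x -> exists k u, s k = Some u /\ N u x) ->
  forall y, shift b E y -> exists k u, tail b (s k) = Some u /\ N u y.
Proof.
  intros H y Hy. destruct (H _ Hy) as [k [u [Hk Hu]]]. exists k. rewrite Hk.
  destruct u as [|c u]; [exists []; split; [reflexivity|]; intros i Hi; simpl in Hi; lia|].
  apply N_cons in Hu. destruct Hu as [-> Hu]. exists u. simpl. rewrite Bool.eqb_reflx. now split.
Qed.

Lemma tail_sums (s : nat -> option (list bool)) r :
  (forall n, sum_f_R0 (fun k => wt (s k)) n <= r) -> forall n,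
  sum_f_R0 (fun k => wt (tail false (s k))) n + sum_f_R0 (fun k => wt (tail true (s k))) n
    <= 2 * r.
Proof.
  intros H n. rewrite <- sum_plus.
  apply Rle_trans with (2 * sum_f_R0 (fun k => wt (s k)) n).
  - rewrite scal_sum. apply Req_le, sum_eq. intros k _. rewrite wt_tail. lra.
  - specialize (H n). lra.
Qed.

(** If the sums along both tails exceeded their share, they would at a common stage. *)
Lemma tail_sums_split (s : nat -> option (list bool)) r a0 a1 :
  (forall n, sum_f_R0 (fun k => wt (s k)) n <= r) -> 2 * r <= a0 + a1 ->
  (forall n, sum_f_R0 (fun k => wt (tail false (s k))) n <= a0) \/
  (forall n, sum_f_R0 (fun k => wt (tail true (s k))) n <= a1).
Proof.
  intros H Ha. apply NNPP. intros Hno. apply not_or_and in Hno. destruct Hno as [H0 H1].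
  apply not_all_ex_not in H0, H1. destruct H0 as [n0 H0], H1 as [n1 H1].
  apply Rnot_le_lt in H0, H1.
  pose proof (tail_sums s r H (Nat.max n0 n1)).
  pose proof (sum_nonneg_mono (fun k => wt (tail false (s k))) n0 (Nat.max n0 n1)
    ltac:(intros; apply wt_nonneg) ltac:(lia)).
  pose proof (sum_nonneg_mono (fun k => wt (tail true (s k))) n1 (Nat.max n0 n1)
    ltac:(intros; apply wt_nonneg) ltac:(lia)).
  lra.
Qed.

(** Covers of the halves are glued for one inequality; a cover of [E] is split into its tails for
    the other. This self-similarity drives the induction in [measurable_N]. *)
Lemma mu_halves E : mu E = (mu (shift false E) + mu (shift true E)) / 2.
Proof.
  apply Rle_antisym.
  - assert (Hc : forall b r, cov (shift b E) r -> cov (fun x => E x /\ x 0%nat = b) (r / 2)).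
    { intros b r [s [H1 H2]].
      exists (fun k => option_map (cons b) (s k)). split.
      - intros x [Hx H0].
        destruct (H1 (fun i => x (S i))) as [k [u [Hk Hu]]].
        { unfold shift. replace (fun i => _) with x; [exact Hx|].
          extensionality i. now destruct i. }
        exists k, (b :: u). rewrite Hk. split; [reflexivity|]. apply N_cons. now split.
      - intros n. apply Rle_trans with (/ 2 * sum_f_R0 (fun k => wt (s k)) n).
        + rewrite scal_sum. apply sum_Rle. intros k _.
          destruct (s k) as [u|]; simpl; unfold muN; simpl; lra.
        + specialize (H2 n). lra. }
    assert (Hm : forall b, mu (fun x => E x /\ x 0%nat = b) <= mu (shift b E) / 2).
    { intros b. apply le_epsilon. intros e He.
      replace (mu (shift b E) / 2 + e) with ((mu (shift b E) + 2 * e) / 2) by lra.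
      apply mu_le_cov, Hc, mu_lt_cov. lra. }
    pose proof (Hm false). pose proof (Hm true).
    assert (mu E <= mu (fun x => E x /\ x 0%nat = false) + mu (fun x => E x /\ x 0%nat = true)).
    { apply mu_union. intros x Hx. destruct (x 0%nat); auto. }
    lra.
  - apply le_epsilon. intros e He. apply Rnot_lt_le. intros Hlt.
    destruct (mu_lt_cov E (mu E + e / 2)) as [s [H1 H2]]; [lra|].
    destruct (tail_sums_split s _ (mu (shift false E) - e / 2) (mu (shift true E) - e / 2) H2)
      as [H|H]; [lra| |].
    + assert (mu (shift false E) <= mu (shift false E) - e / 2); [|lra].
      apply mu_le_cov. exists (fun k => tail false (s k)).
      split; [exact (tail_cover false E s H1)|exact H].
    + assert (mu (shift true E) <= mu (shift true E) - e / 2); [|lra].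
      apply mu_le_cov. exists (fun k => tail true (s k)).
      split; [exact (tail_cover true E s H1)|exact H].
Qed.

(** A cover of total weight below 1 leaves a point uncovered: keep moving into a half of the
    space in which the rescaled weight stays below 1. *)
Lemma mu_full : 1 <= mu (fun _ => True).
Proof.
  apply Rnot_lt_le. intros Hlt.
  set (r := (mu (fun _ => True) + 1) / 2).
  assert (Hr : r < 1) by (unfold r; lra).
  destruct (mu_lt_cov (fun _ => True) r) as [s [H1 H2]]; [unfold r; lra|].
  set (light := fun s : nat -> option (list bool) =>
    forall n, sum_f_R0 (fun k => wt (s k)) n <= r).
  destruct (choose (fun s b => light s -> light (fun k => tail b (s k)))) as [g Hg].
  { intros q. destruct (classic (light q)) as [Hq|Hq]; [|exists false; tauto].
    destruct (tail_sums_split q r r r Hq) as [H|H]; [lra|now exists false|now exists true]. }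
  set (st := fix st n := match n with 0%nat => s | S n => fun k => tail (g (st n)) (st n k) end).
  assert (Hst : forall n, light (st n)).
  { induction n as [|n IH]; [exact H2|]. now apply Hg. }
  destruct (H1 (fun n => g (st n)) I) as [k [u [Hk Hu]]].
  (* A cylinder of the cover containing the branch loses one bit per stage and ends as the whole
     space, whose weight 1 exceeds [r]. *)
  assert (Hend : forall n v, st n k = Some v -> N v (fun i => g (st (n + i)%nat)) ->
    exists m, st m k = Some []).
  { intros n v. revert n. induction v as [|c v IH]; intros n Hn Hv; [eauto|].
    apply N_cons in Hv. destruct Hv as [Hc Hv]. rewrite Nat.add_0_r in Hc.
    apply (IH (S n)).
    - simpl. rewrite Hn. simpl. now rewrite Hc, Bool.eqb_reflx.
    - replace (fun i => g (st (S n + i)%nat)) with (fun i => g (st (n + S i)%nat)); [exact Hv|].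
      extensionality i. do 2 f_equal. lia. }
  destruct (Hend 0%nat u Hk Hu) as [m Hm].
  pose proof (Hst m k).
  pose proof (sum_nonneg_term (fun k => wt (st m k)) k ltac:(intros; apply wt_nonneg)) as Ht.
  simpl in Ht. rewrite Hm in Ht. change (wt (Some [])) with 1 in Ht. lra.
Qed.

(** * The Caratheodory condition *)

Lemma measurable_iff A : measurable A <->
  forall E : cset, mu E = mu (fun x => E x /\ A x) + mu (fun x => E x /\ ~ A x).
Proof.
  split.
  - intros H E. apply (H E); apply outer_mu.
  - intros H E mE m1 m2 HE H1 H2. rewrite outer_iff in *. subst. apply H.
Qed.

(** On the half selected by [b] the set [N (b :: t)] becomes [N t]; the other half misses it. *)
Lemma measurable_N t : measurable (N t).
Proof.
  apply measurable_iff. induction t as [|b t IH]; intros E.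
  - rewrite (mu_empty (fun x => E x /\ ~ N [] x)).
    + rewrite Rplus_0_r. f_equal. apply cset_ext. intros x. split; [|tauto].
      intros H. split; [exact H|]. intros i Hi. simpl in Hi. lia.
    + intros x [_ H]. apply H. intros i Hi. simpl in Hi. lia.
  - rewrite (mu_halves E), (mu_halves (fun x => E x /\ N (b :: t) x)),
      (mu_halves (fun x => E x /\ ~ N (b :: t) x)).
    assert (Hb : forall c y, N (b :: t) (fun i => match i with 0%nat => c | S i => y i end)
              <-> c = b /\ N t y).
    { intros c y. apply N_cons. }
    assert (Hin : shift b (fun x => E x /\ N (b :: t) x) = (fun y => shift b E y /\ N t y)).
    { apply cset_ext. intros y. unfold shift. rewrite Hb. tauto. }
    assert (Hout : shift b (fun x => E x /\ ~ N (b :: t) x) = (fun y => shift b E y /\ ~ N t y)).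
    { apply cset_ext. intros y. unfold shift. rewrite Hb. tauto. }
    assert (Hin' : mu (shift (negb b) (fun x => E x /\ N (b :: t) x)) = 0).
    { apply mu_empty. intros y. unfold shift. rewrite Hb.
      destruct b; intros [_ [H _]]; discriminate. }
    assert (Hout' : shift (negb b) (fun x => E x /\ ~ N (b :: t) x) = shift (negb b) E).
    { apply cset_ext. intros y. unfold shift. rewrite Hb.
      destruct b; simpl; intuition discriminate. }
    pose proof (IH (shift b E)) as H. rewrite <- Hin, <- Hout in H.
    destruct b; simpl negb in *; rewrite Hin', Hout'; lra.
Qed.

Lemma measurable_not A : measurable A -> measurable (fun x => ~ A x).
Proof.
  rewrite !measurable_iff. intros H E. rewrite (H E), Rplus_comm. f_equal.
  f_equal. apply cset_ext. intros x. split; [tauto|]. intros [H1 H2].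
  split; [exact H1|now apply NNPP].
Qed.

Lemma measurable_inter A B :
  measurable A -> measurable B -> measurable (fun x => A x /\ B x).
Proof.
  rewrite !measurable_iff. intros HA HB E.
  rewrite (HA E), (HB (fun x => E x /\ A x)), (HA (fun x => E x /\ ~ (A x /\ B x))).
  rewrite <- Rplus_assoc.
  replace (fun x => (E x /\ A x) /\ B x) with (fun x => E x /\ A x /\ B x)
    by (apply cset_ext; tauto).
  replace (fun x => (E x /\ ~ (A x /\ B x)) /\ A x) with (fun x => (E x /\ A x) /\ ~ B x)
    by (apply cset_ext; tauto).
  replace (fun x => (E x /\ ~ (A x /\ B x)) /\ ~ A x) with (fun x => E x /\ ~ A x)
    by (apply cset_ext; tauto).
  lra.
Qed.

Lemma measurable_union A B :
  measurable A -> measurable B -> measurable (fun x => A x \/ B x).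
Proof.
  intros HA HB.
  replace (fun x => A x \/ B x) with (fun x => ~ (~ A x /\ ~ B x)).
  - apply measurable_not, measurable_inter; now apply measurable_not.
  - apply cset_ext. intros x. split; [intros H; apply NNPP; tauto|tauto].
Qed.

(** * Nowhere dense closed sets of almost full measure *)

(** The union is a dense open set of measure at most [2^-c]; its complement is the nowhere dense
    closed set to work in. *)
Definition fat_open (c : nat) (t : nat -> list bool) : Prop :=
  (forall s, exists n, prefix s (t n)) /\
  (forall n, muN (t n) <= (/ 2) ^ c * (/ 2) ^ S n).

Lemma fat_open_exists c : exists t, fat_open c t.
Proof.
  destruct strings_countable as [e He].
  exists (fun n => e n ++ repeat false (c + S n)). split.
  - intros s. destruct (He s) as [n <-]. exists n. now eexists.
  - intros n. unfold muN. rewrite length_app, repeat_length, <- pow_add, pow_add.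
    pose proof (half_pow_le_1 (length (e n))). pose proof (half_pow_pos (c + S n)). nra.
Qed.

Definition union_of (t : nat -> list bool) : cset := fun x => exists n, N (t n) x.

Lemma mu_fat_tail c t m : fat_open c t ->
  mu (fun x => exists n, (m <= n)%nat /\ N (t n) x) <= (/ 2) ^ m * (/ 2) ^ c.
Proof.
  intros [_ Ht].
  apply Rle_trans with (mu (fun x => exists n, N (t (m + n)%nat) x)).
  - apply mu_mono. intros x [n [Hn Hx]]. exists (n - m)%nat.
    now replace (m + (n - m))%nat with n by lia.
  - apply mu_countable_union with (a := fun n => (/ 2) ^ m * (/ 2) ^ c * (/ 2) ^ S n).
    + intros n. eapply Rle_trans; [apply mu_cyl|]. specialize (Ht (m + n)%nat).
      replace (S (m + n)) with (m + S n)%nat in Ht by lia. rewrite pow_add in Ht. lra.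
    + intros n. apply sum_half_pow.
      apply Rlt_le, Rmult_lt_0_compat; apply half_pow_pos.
Qed.

Lemma mu_fat c t : fat_open c t -> mu (union_of t) <= (/ 2) ^ c.
Proof.
  intros Ht. pose proof (mu_fat_tail c t 0 Ht) as H. rewrite pow_O, Rmult_1_l in H.
  eapply Rle_trans; [|exact H]. apply mu_mono. intros x [n Hn]. exists n. split; [lia|exact Hn].
Qed.

(** The first [m] cylinders form a measurable set, and the others add outer measure at most
    [2^-m]. *)
Lemma measurable_fat c t : fat_open c t -> measurable (union_of t).
Proof.
  intros Ht. apply measurable_iff. intros E. apply Rle_antisym.
  { apply mu_union. intros x Hx. destruct (classic (union_of t x)); auto. }
  apply le_epsilon. intros e He. destruct (half_pow_small e He) as [m Hm].
  assert (HU : measurable (fun x => exists n, (n < m)%nat /\ N (t n) x)).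
  { clear Hm. induction m as [|m IH].
    - replace (fun x => _) with (fun x => ~ N [] x); [apply measurable_not, measurable_N|].
      apply cset_ext. intros x. split; [|intros [n [Hn _]]; lia].
      intros H. exfalso. apply H. intros i Hi. simpl in Hi. lia.
    - replace (fun x => _) with (fun x => (exists n, (n < m)%nat /\ N (t n) x) \/ N (t m) x).
      + apply measurable_union; [exact IH|apply measurable_N].
      + apply cset_ext. intros x. split.
        * intros [[n [Hn H]]|H]; [exists n|exists m]; split; auto; lia.
        * intros [n [Hn H]]. destruct (Nat.eq_dec n m) as [->|]; [auto|].
          left. exists n. split; [lia|exact H]. }
  rewrite (proj1 (measurable_iff _) HU E).
  pose proof (mu_fat_tail c t m Ht) as Htail.
  assert (H1 : mu (fun x => E x /\ union_of t x) <=
     mu (fun x => E x /\ exists n, (n < m)%nat /\ N (t n) x) +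
     mu (fun x => exists n, (m <= n)%nat /\ N (t n) x)).
  { apply mu_union. intros x [Hx [n Hn]].
    destruct (Nat.lt_ge_cases n m); [left|right]; eauto. }
  assert (H2 : mu (fun x => E x /\ ~ union_of t x) <=
     mu (fun x => E x /\ ~ exists n, (n < m)%nat /\ N (t n) x)).
  { apply mu_mono. intros x [Hx Hn]. split; [exact Hx|]. intros [n [_ H]]. apply Hn. now exists n. }
  pose proof (half_pow_le_1 c). pose proof (half_pow_pos m). pose proof (half_pow_pos c). nra.
Qed.

(** * Density along a branch *)

Lemma prefix_comparable a b v :
  prefix a v -> prefix b v -> (length a <= length b)%nat -> prefix a b.
Proof.
  intros Ha Hb Hl. destruct (N_inhabited v) as [x Hx].
  apply N_comparable with x; [now apply N_prefix with v|now apply N_prefix with v|exact Hl].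
Qed.

Lemma prefix_antisym a b : prefix a b -> prefix b a -> a = b.
Proof.
  intros [v ->] H. apply prefix_length in H. rewrite length_app in H.
  destruct v as [|c v]; [now rewrite app_nil_r|simpl in H; lia].
Qed.

Lemma prefix_snoc_inv a u b : prefix a (u ++ [b]) -> prefix a u \/ a = u ++ [b].
Proof.
  intros H. pose proof (prefix_length _ _ H) as Hl. rewrite length_app in Hl. simpl in Hl.
  destruct (Nat.le_gt_cases (length a) (length u)) as [Hle|Hgt].
  - left. apply prefix_comparable with (u ++ [b]); [exact H|apply prefix_snoc|exact Hle].
  - right. apply prefix_antisym; [exact H|].
    apply prefix_comparable with (u ++ [b]); [apply prefix_refl|exact H|].
    rewrite length_app. simpl. lia.
Qed.

Definition den (B : cset) (s : list bool) : R := mu (fun x => B x /\ N s x) / muN s.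

Lemma den_mul B s : mu (fun x => B x /\ N s x) = den B s * muN s.
Proof. unfold den. pose proof (muN_pos s). field. lra. Qed.

Lemma den_le_1 B s : den B s <= 1.
Proof.
  apply Rmult_le_reg_r with (muN s); [apply muN_pos|]. rewrite <- den_mul, Rmult_1_l.
  eapply Rle_trans; [|apply mu_cyl]. apply mu_mono. tauto.
Qed.

(** The martingale inequality: subadditivity over two halves of equal measure. *)
Lemma den_children B s : den B s <= (den B (s ++ [false]) + den B (s ++ [true])) / 2.
Proof.
  apply Rmult_le_reg_r with (muN s); [apply muN_pos|]. rewrite <- den_mul.
  replace (_ / 2 * muN s) with
    (den B (s ++ [false]) * (muN s / 2) + den B (s ++ [true]) * (muN s / 2)) by lra.
  rewrite <- (muN_snoc s false) at 1. rewrite <- (muN_snoc s true), <- !den_mul.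
  apply mu_union. intros x [Hx Hs]. destruct (N_children s x Hs); auto.
Qed.

(** The sibling has density at most 1, so in one step the deficit from 1 at most doubles. *)
Lemma den_child_lower B s b : 2 * den B s - 1 <= den B (s ++ [b]).
Proof.
  pose proof (den_children B s). pose proof (den_le_1 B (s ++ [false])).
  pose proof (den_le_1 B (s ++ [true])). destruct b; lra.
Qed.

Lemma den_child_greater B s : exists b, den B s <= den B (s ++ [b]).
Proof.
  pose proof (den_children B s).
  destruct (Rle_dec (den B s) (den B (s ++ [false]))); [now exists false|].
  exists true. lra.
Qed.

(** A weak Lebesgue density theorem: were all densities below [s] at most [c], the pieces of [B] in
    an efficient cover would have total measure less than [mu B]. *)
Lemma dense_cylinder (B : cset) s c :
  (forall x, B x -> N s x) -> 0 < mu B -> 0 <= c < 1 ->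
  exists u, prefix s u /\ c < den B u.
Proof.
  intros HB Hmu Hc. apply NNPP. intros Hno.
  assert (Hle : forall u, prefix s u -> mu (fun x => B x /\ N u x) <= c * muN u).
  { intros u Hu. rewrite den_mul. apply Rmult_le_compat_r; [apply Rlt_le, muN_pos|].
    apply Rnot_lt_le. intros H. apply Hno. now exists u. }
  (* Chosen so that [r] exceeds [mu B] while [c * r] stays below it. *)
  set (r := mu B * (2 / (1 + c))).
  assert (Hr : mu B < r /\ c * r < mu B).
  { assert (H2 : r * (1 + c) = 2 * mu B) by (unfold r; field; lra).
    split; nra. }
  destruct (mu_lt_cov B r) as [q [H1 H2]]; [apply Hr|].
  assert (mu B <= c * r); [|lra].
  apply Rle_trans with (mu (fun x => exists k, B x /\ exists u, q k = Some u /\ N u x)).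
  { apply mu_mono. intros x Hx. destruct (H1 x Hx) as [k Hk]. now exists k. }
  apply mu_countable_union with (a := fun k => wt (q k) * c).
  - intros k. destruct (q k) as [u|]; simpl.
    + apply Rle_trans with (mu (fun x => B x /\ N u x)).
      { apply mu_mono. intros x [Hx [v [Hv Hvx]]]. injection Hv as <-. now split. }
      (* A cylinder of the cover lies below [s], or contains [N s] and obeys the bound at [s], or is
         disjoint from [N s] and carries nothing of [B]. *)
      destruct (classic (exists x, N s x /\ N u x)) as [[x [Hs Hu]]|Hdis].
      * destruct (Nat.le_ge_cases (length s) (length u)) as [Hl|Hl].
        -- rewrite (Rmult_comm (muN u)). apply Hle. now apply N_comparable with x.
        -- assert (Hp : prefix u s) by now apply N_comparable with x.
           specialize (Hle s (prefix_refl s)). pose proof (muN_prefix _ _ Hp).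
           assert (mu (fun x => B x /\ N u x) <= mu (fun x => B x /\ N s x)).
           { apply mu_mono. intros y [Hy _]. auto. }
           nra.
      * rewrite mu_empty; [pose proof (muN_pos u); nra|].
        intros x [Hx Hu]. apply Hdis. eauto.
    + rewrite mu_empty; [lra|]. intros x [_ [u [Hu _]]]. discriminate.
  - intros n. rewrite <- scal_sum. apply Rmult_le_compat_l; [apply Hc|apply H2].
Qed.

(** A stopping-time decomposition: the first passage to density at most [d] occurs [n] steps below
    [s]. *)
Fixpoint first_low (B : cset) (d : R) (n : nat) (s : list bool) : cset :=
  match n with
  | O => fun x => den B s <= d /\ N s x
  | S n => fun x => d < den B s /\
      (first_low B d n (s ++ [false]) x \/ first_low B d n (s ++ [true]) x)
  end.

(** The measure of [first_low B d n s]; computing it recursively gives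
    [low_weight_sum] without additivity over an infinite antichain. *)
Fixpoint low_weight (B : cset) (d : R) (n : nat) (s : list bool) : R :=
  match n with
  | O => if Rle_dec (den B s) d then muN s else 0
  | S n => if Rle_dec (den B s) d then 0
           else low_weight B d n (s ++ [false]) + low_weight B d n (s ++ [true])
  end.

Lemma low_weight_sum B d n s : sum_f_R0 (fun k => low_weight B d k s) n <= muN s.
Proof.
  revert s. induction n as [|n IH]; intros s.
  - simpl. pose proof (muN_pos s). destruct (Rle_dec (den B s) d); lra.
  - rewrite decomp_sum by lia. simpl Nat.pred. pose proof (muN_pos s).
    cbn [low_weight]. destruct (Rle_dec (den B s) d) as [Hd|Hd].
    + rewrite sum_cte. lra.
    + rewrite sum_plus. specialize (IH (s ++ [false])) as H0. specialize (IH (s ++ [true])).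
      rewrite muN_snoc in *. lra.
Qed.

Lemma mu_first_low B d n s :
  mu (fun x => B x /\ first_low B d n s x) <= low_weight B d n s * d.
Proof.
  revert s. induction n as [|n IH]; intros s; simpl; destruct (Rle_dec (den B s) d) as [Hd|Hd].
  - apply Rle_trans with (mu (fun x => B x /\ N s x)); [apply mu_mono; tauto|].
    rewrite den_mul. pose proof (muN_pos s). nra.
  - rewrite mu_empty; [lra|tauto].
  - rewrite mu_empty; [lra|]. intros x [_ [H _]]. lra.
  - rewrite Rmult_plus_distr_r.
    eapply Rle_trans; [|apply Rplus_le_compat; apply IH].
    apply mu_union. tauto.
Qed.

Lemma first_low_complete B d w s x :
  den B (s ++ w) <= d -> N (s ++ w) x -> exists n, first_low B d n s x.
Proof.
  revert s. induction w as [|c w IH]; intros s Hd Hx.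
  - rewrite app_nil_r in *. now exists 0%nat.
  - destruct (Rle_dec (den B s) d) as [Hs|Hs].
    + exists 0%nat. split; [exact Hs|]. apply N_prefix with (s ++ c :: w); [now eexists|exact Hx].
    + replace (s ++ c :: w) with ((s ++ [c]) ++ w) in * by now rewrite <- app_assoc.
      destruct (IH _ Hd Hx) as [n Hn]. exists (S n). split; [lra|]. destruct c; auto.
Qed.

(** The part of [B] on which the density drops to [d] has measure at most [d * muN s], so the
    rest of [B] in [N s] is not null and has density close to 1 somewhere. *)
Lemma density_climb B s d c : 0 <= d < den B s -> 0 <= c < 1 ->
  exists u, prefix s u /\ (length s < length u)%nat /\ c < den B u /\
    forall v, prefix s v -> prefix v u -> d < den B v.
Proof.
  intros Hd Hc.
  set (B' := fun x => (B x /\ N s x) /\ ~ exists n, first_low B d n s x).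
  assert (Hpos : 0 < mu B').
  { pose proof (muN_pos s).
    assert (H1 : mu (fun x => B x /\ N s x) <=
      mu (fun x => exists n, B x /\ first_low B d n s x) + mu B').
    { apply mu_union. intros x Hx.
      destruct (classic (exists n, first_low B d n s x)) as [[n Hn]|Hn].
      - left. exists n. tauto.
      - right. now split. }
    assert (H2 : mu (fun x => exists n, B x /\ first_low B d n s x) <= d * muN s).
    { apply mu_countable_union with (a := fun n => low_weight B d n s * d).
      - intros n. apply mu_first_low.
      - intros n. rewrite <- scal_sum. apply Rmult_le_compat_l; [lra|apply low_weight_sum]. }
    rewrite den_mul in H1. nra. }
  destruct (dense_cylinder B' s c) as [u [Hsu Hu]]; [unfold B'; tauto|exact Hpos|exact Hc|].
  assert (Hge : den B' u <= den B u).
  { apply Rmult_le_compat_r; [apply Rlt_le, Rinv_0_lt_compat, muN_pos|].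
    apply mu_mono. unfold B'. tauto. }
  (* The branch of such a point never reaches low density, which certifies all strings between [s]
     and [u]. *)
  assert (Hx : exists x, B' x /\ N u x).
  { apply NNPP. intros Hno. pose proof (den_mul B' u) as H. rewrite mu_empty in H by eauto.
    pose proof (muN_pos u). nra. }
  destruct Hx as [x [[_ Hx] Hux]].
  assert (Hpath : forall v, prefix s v -> prefix v u -> d < den B v).
  { intros v [w ->] Hvu. apply Rnot_le_lt. intros Hle. apply Hx.
    apply first_low_complete with w; [exact Hle|]. now apply N_prefix with u. }
  (* [u] may be [s] itself; one more bit that does not lower the density makes the extension
     proper. *)
  destruct (den_child_greater B u) as [b Hb].
  pose proof (Hpath u Hsu (prefix_refl u)).
  exists (u ++ [b]). split; [apply prefix_trans with u; [exact Hsu|apply prefix_snoc]|].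
  split; [|split; [lra|]].
  - apply prefix_length in Hsu. rewrite length_app. simpl. lia.
  - intros v Hv Hvu. destruct (prefix_snoc_inv _ _ _ Hvu) as [H'| ->]; [auto|lra].
Qed.

(** Stop at the first string of density at most [d]: its parent is still above [d], so
    [den_child_lower] bounds the overshoot. *)
Lemma density_drop B d w s : d <= 1 -> d < den B s -> den B (s ++ w) <= d ->
  exists v, prefix s v /\ den B v <= d /\
    forall z, prefix s z -> prefix z v -> 2 * d - 1 < den B z.
Proof.
  intros Hd1. revert s. induction w as [|c w IH]; intros s Hs Hw.
  - rewrite app_nil_r in Hw. lra.
  - destruct (Rle_dec (den B (s ++ [c])) d) as [Hc|Hc].
    + exists (s ++ [c]). split; [apply prefix_snoc|split; [exact Hc|]].
      intros z Hz1 Hz2. destruct (prefix_snoc_inv _ _ _ Hz2) as [H| ->].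
      * rewrite <- (prefix_antisym _ _ Hz1 H). lra.
      * pose proof (den_child_lower B s c). lra.
    + replace (s ++ c :: w) with ((s ++ [c]) ++ w) in Hw by now rewrite <- app_assoc.
      destruct (IH (s ++ [c])) as [v [H1 [H2 H3]]]; [lra|exact Hw|].
      exists v. split; [apply prefix_trans with (s ++ [c]); [apply prefix_snoc|exact H1]|].
      split; [exact H2|]. intros z Hz1 Hz2.
      destruct (Nat.le_gt_cases (length z) (length s)) as [Hl|Hl].
      * assert (z = s) as ->; [|lra]. apply prefix_antisym; [|exact Hz1].
        apply prefix_comparable with v; [exact Hz2| |exact Hl].
        apply prefix_trans with z; assumption.
      * apply H3; [|exact Hz2]. apply prefix_comparable with v; [exact H1|exact Hz2|].
        rewrite length_app. simpl. lia.
Qed.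

(** * The scale of densities and the reduction to [Phi B] *)

(** Halving the deficit at each level matches [den_child_lower]: a first fall to [level (S k)] ends
    above [level k]. *)
Definition level (k : nat) : R := 1 - (/ 2) ^ k.

Lemma level_bounds k : 0 <= level k < 1.
Proof. unfold level. pose proof (half_pow_pos k). pose proof (half_pow_le_1 k). lra. Qed.

Lemma level_S k : 2 * level (S k) - 1 = level k.
Proof. unfold level. simpl. lra. Qed.

Lemma level_mono j k : (j <= k)%nat -> level j <= level k.
Proof.
  intros H. induction H as [|k H IH]; [lra|].
  pose proof (level_S k). pose proof (level_bounds k). lra.
Qed.

(** Densities never exceed 1, so convergence to 1 is a one-sided condition. *)
Lemma Phi_iff B x :
  Phi B x <-> forall k, exists n, forall j, (n <= j)%nat -> level k < den B (restr x j).
Proof.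
  split.
  - intros [m [Hm Hcv]] k. destruct (Hcv ((/ 2) ^ k) (half_pow_pos k)) as [n Hn].
    exists n. intros j Hj. specialize (Hn j Hj).
    rewrite (proj1 (outer_iff _ _) (Hm j)) in Hn. fold (den B (restr x j)) in Hn.
    unfold Rdist in Hn. apply Rabs_def2 in Hn. unfold level. lra.
  - intros H. exists (fun n => mu (fun y => B y /\ N (restr x n) y)).
    split; [intros n; apply outer_mu|]. intros e He.
    destruct (half_pow_small e He) as [k Hk]. destruct (H k) as [n Hn].
    exists n. intros j Hj. specialize (Hn j Hj). fold (den B (restr x j)).
    pose proof (den_le_1 B (restr x j)). unfold Rdist, level in *. apply Rabs_def1; lra.
Qed.

(** The innermost condition is closed, because each density depends on a finite part of [x]. *)
Lemma Pi03_Phi B : Pi03 (Phi B).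
Proof.
  exists (fun k x => exists n, forall j, (n <= j)%nat -> level k < den B (restr x j)).
  split; [|intros x; apply Phi_iff].
  intros k. exists (fun n x => forall j, (n <= j)%nat -> level k < den B (restr x j)).
  split; [|reflexivity].
  intros n x Hx. apply not_all_ex_not in Hx. destruct Hx as [j Hj].
  exists j. intros y Hy H. apply Hj. intros Hn. specialize (H j Hn).
  pose proof (restr_N _ _ Hy) as E. rewrite length_restr in E. now rewrite E in H.
Qed.

(** A one in row [i] makes the density along the branch drop into [(level i, level (S i)]];
    otherwise it climbs towards 1. *)
Lemma P3_le_Phi B : 0 < mu B ->
  (forall s, exists u, prefix s u /\ mu (fun x => B x /\ N u x) = 0) -> wadge_le P3 (Phi B).
Proof.
  intros Hpos Hnull.
  assert (Hzero : forall s, exists w, den B (s ++ w) <= 0).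
  { intros s. destruct (Hnull s) as [u [[w ->] Hw]]. exists w. unfold den. rewrite Hw. lra. }
  set (Inv := fun t s => level (S t) < den B s).
  set (Rel := fun t (b : bool) s u =>
    (forall v, prefix s v -> prefix v u -> level (if b then row t else t) < den B v) /\
    (b = true -> exists v, prefix s v /\ prefix v u /\ den B v <= level (S (row t)))).
  (* The empty string has density [mu B], above the floor 0; one climb establishes the invariant at
     stage 0. *)
  destruct (density_climb B [] 0 (level 1)) as [s0 [_ [_ [Hs0 _]]]].
  { split; [lra|]. unfold den. apply Rmult_lt_0_compat.
    - replace (fun x => B x /\ N [] x) with B; [exact Hpos|].
      apply cset_ext. intros x. split; [|tauto]. intros H. split; [exact H|].
      intros i Hi. simpl in Hi. lia.
    - apply Rinv_0_lt_compat, muN_pos. }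
  { apply level_bounds. }
  destruct (transducer (list bool) (fun s => s) Inv Rel s0) as [f [Hf Hrun]].
  - exact Hs0.
  - intros t b s Hs. unfold Inv in Hs. destruct b.
    + pose proof (row_le t) as Hrow.
      pose proof (level_mono (S (row t)) (S t) ltac:(lia)).
      pose proof (level_bounds (S (row t))). pose proof (level_S (row t)).
      destruct (Hzero s) as [w Hw].
      (* As [row t <= t], the invariant puts the current density above the level to be crossed. *)
      destruct (density_drop B (level (S (row t))) w s) as [v [V1 [V2 V3]]]; [lra|lra|lra|].
      destruct (density_climb B v (level (row t)) (level (S (S t)))) as [u [U1 [U2 [U3 U4]]]].
      * split; [apply level_bounds|].
        specialize (V3 v V1 (prefix_refl v)). lra.
      * apply level_bounds.
      * exists u. split; [exact U3|split; [split|split]].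
        -- intros z Hz1 Hz2.
           destruct (Nat.le_gt_cases (length v) (length z)) as [Hl|Hl].
           ++ apply U4; [|exact Hz2]. now apply prefix_comparable with u.
           ++ assert (prefix z v) by (apply prefix_comparable with u; auto; lia).
              specialize (V3 z Hz1 ltac:(assumption)). lra.
        -- intros _. exists v. auto.
        -- apply prefix_trans with v; assumption.
        -- apply prefix_length in V1. lia.
    + pose proof (level_bounds (S t)). pose proof (level_mono t (S t) ltac:(lia)).
      destruct (density_climb B s (level (S t)) (level (S (S t)))) as [u [U1 [U2 [U3 U4]]]];
        [lra|apply level_bounds|].
      exists u. split; [exact U3|split; [split|split]]; try assumption; [|discriminate].
      intros v Hv1 Hv2. specialize (U4 v Hv1 Hv2). lra.
  - exists f. split; [exact Hf|]. intros a. destruct (Hrun a) as [run Hr].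
    rewrite Phi_iff. split.
    + intros HP k. destruct (P3_rows_below a k) as [T HT]; [intros i _; apply HP|].
      set (T' := Nat.max T k). exists (length (run T')). intros j Hj.
      (* Locates the stage whose block contains the prefix of length [j]; it is at least [T'], so
         its floor is at least [level k]. *)
      destruct (least_nat (fun t => (j < length (run t))%nat)) as [t' [Ht' Hmin]].
      { exists (S j). destruct (Hr (S j)) as [_ [_ [_ [? _]]]]. lia. }
      assert (Hmono : forall t n, (n <= t)%nat -> (length (run n) <= length (run t))%nat).
      { intros t n Hn. induction Hn as [|t Hn IH]; [lia|].
        destruct (Hr t) as [_ [_ [Hp _]]]. apply prefix_length in Hp. lia. }
      assert (HT' : (T' < t')%nat).
      { apply Nat.nle_gt. intros Hle. specialize (Hmono T' t' Hle). lia. }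
      destruct t' as [|t]; [lia|].
      specialize (Hmin t ltac:(lia)).
      destruct (Hr t) as [_ [[HR _] [_ [_ HN]]]]. destruct (Hr (S t)) as [_ [_ [_ [_ HN']]]].
      apply Rle_lt_trans with (level (if a t then row t else t)).
      * apply level_mono. destruct (a t) eqn:E; [|lia].
        apply Nat.nlt_ge. intros Hlt. rewrite HT in E by lia. discriminate.
      * apply HR; [apply prefix_restr; [exact HN|lia]|].
        apply N_comparable with (f a); [apply N_restr_self|exact HN'|rewrite length_restr; lia].
    + intros HPhi. apply NNPP. intros HnP. destruct (not_P3 a HnP) as [i [_ Hinf]].
      destruct (HPhi (S i)) as [n Hn]. destruct (Hinf n) as [t [Ht [Hrow Hat]]].
      destruct (Hr t) as [_ [[_ HR] [_ [Hl _]]]]. destruct (Hr (S t)) as [_ [_ [_ [_ HN']]]].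
      destruct (HR Hat) as [v [Hv1 [Hv2 Hv3]]].
      pose proof (N_prefix _ _ _ Hv2 HN') as Hv. pose proof (prefix_length _ _ Hv1).
      specialize (Hn (length v) ltac:(lia)). rewrite (restr_N v _ Hv), <- Hrow in Hn. lra.
Qed.

(** * The Wadge degree of [Phi B] *)

(** The double negation has the shape that [dense_in_MALG] gives for the complement of [union_of t];
    [B] is null on every [N (t n)], and these occur below every string. *)
Lemma P3_le_Phi_fat B c t : fat_open c t -> 0 < mu B ->
  mu (fun x => B x /\ ~ ~ union_of t x) = 0 -> wadge_le P3 (Phi B).
Proof.
  intros [Ht _] Hpos Hnull. apply P3_le_Phi; [exact Hpos|].
  intros s. destruct (Ht s) as [n Hn]. exists (t n). split; [exact Hn|].
  apply Rle_antisym; [|apply mu_nonneg]. rewrite <- Hnull. apply mu_mono.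
  intros x [HB Hx]. split; [exact HB|]. intros H. apply H. now exists n.
Qed.

(** All properly [Pi03] sets are equivalent to [P3], so [d_Pi03] is a single Wadge degree,
    represented by any such [Y]. *)
Lemma d_Pi03_iff X Y : Pi03 Y -> wadge_le P3 Y ->
  (d_Pi03 X <-> wadge_le X Y /\ wadge_le Y X).
Proof.
  intros HY HPY. split.
  - intros [HX HD].
    assert (HPX : wadge_le P3 X).
    { apply P3_le_proper_Pi03; [exact HX|]. intros HS. apply HD. now split. }
    split; eapply wadge_trans; eauto; now apply Pi03_le_P3.
  - intros [HXY HYX]. split; [now apply Pi03_wadge with Y|].
    intros [_ HS]. apply P3_not_Sigma03. apply Sigma03_wadge with X; [|exact HS].
    now apply wadge_trans with Y.
Qed.

Lemma wadge_refl X : wadge_le X X.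
Proof.
  exists (fun x => x). split; [|reflexivity].
  intros x n. exists n. intros y Hy. now apply N_restr.
Qed.

Lemma pos_outer_mu A : (exists m, outer A m /\ 0 < m) <-> 0 < mu A.
Proof.
  split; [intros [m [Hm Hp]]; now rewrite outer_iff in Hm; subst|].
  intros H. exists (mu A). split; [apply outer_mu|exact H].
Qed.

Theorem theorem1p9 :
  dense_in_MALG (W d_Pi03) /\
  (forall e : cset -> Prop, wadge_degree e -> dense_in_MALG (W e) ->
     forall X, e X <-> d_Pi03 X).
Proof.
  split.
  - intros A HA Hpos. rewrite pos_outer_mu in Hpos.
    (* Removing an open set of measure at most [2^-c < mu A] leaves a set of positive measure. *)
    destruct (half_pow_small (mu A) Hpos) as [c Hc].
    destruct (fat_open_exists c) as [t Ht].
    set (B := fun x => A x /\ ~ union_of t x).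
    assert (HB : 0 < mu B).
    { pose proof (mu_fat c t Ht).
      assert (mu A <= mu B + mu (union_of t)); [|lra].
      apply mu_union. intros x Hx. destruct (classic (union_of t x)); [auto|].
      left. now split. }
    exists B. split; [|split; [|split]].
    + apply measurable_inter; [exact HA|]. apply measurable_not. now apply measurable_fat with c.
    + apply (d_Pi03_iff (Phi B) (Phi B)); [apply Pi03_Phi| |split; apply wadge_refl].
      apply (P3_le_Phi_fat B c t Ht HB), mu_empty. unfold B. tauto.
    + now apply pos_outer_mu.
    + apply outer_iff. symmetry. apply mu_empty. unfold B. tauto.
  - intros e [Y HY] He X.
    (* Exponent 1 leaves a complement of measure at least 1/2. *)
    destruct (fat_open_exists 1) as [t Ht].
    destruct (He (fun x => ~ union_of t x)) as [B [_ [HWB [HBpos HBnull]]]].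
    + apply measurable_not. now apply measurable_fat with 1%nat.
    + apply pos_outer_mu. pose proof (mu_fat 1 t Ht). pose proof mu_full.
      assert (mu (fun _ => True) <= mu (fun x => ~ union_of t x) + mu (union_of t)).
      { apply mu_union. intros x _. destruct (classic (union_of t x)); auto. }
      simpl in *. lra.
    + rewrite pos_outer_mu in HBpos. rewrite outer_iff in HBnull.
      rewrite (d_Pi03_iff X (Phi B)); [|apply Pi03_Phi|].
      (* [Phi B] is a common member of [e] and [d_Pi03], and both are its equivalence class. *)
      * apply HY in HWB. destruct HWB as [H1 H2]. rewrite HY.
        split; intros [H3 H4]; split; eapply wadge_trans; eauto.
      * apply (P3_le_Phi_fat B 1 t Ht HBpos). now symmetry.
Qed.
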